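(* Let $r\ge2$ and consider the $r$-states i.i.d. model described in the context, with $n$ users, and let $f_{\mathbf{P}}$ be a continuous density for which there are $\delta_1,\delta_2>0$ with $\delta_1<f_{\mathbf{P}}(\mathbf{p})<\delta_2$ for $\mathbf{p}\in\mathcal{R}_{\mathbf{p}}$ and $f_{\mathbf{P}}(\mathbf{p})=0$ for $\mathbf{p}\notin\mathcal{R}_{\mathbf{p}}$. Suppose that $m=cn^{\frac{2}{r-1}+\alpha}$ for some $c>0$ and $0<\alpha<1$, and that $R_u\sim\mathrm{Uniform}[0,a_n]$ with $a_n=c'n^{-\left(\frac{1}{r-1}+\beta\right)}$ for some $c'>0$ and $\beta>\frac{\alpha}{4}$. Then user $1$ has no privacy as $n\to\infty$; that is, for every $k\in\mathbb{N}$, $$\inf_{\widetilde{X_1(k)}} P\left(\widetilde{X_1(k)}\ne X_1(k)\right)\longrightarrow 0\quad\text{as } n\to\infty,$$ where the infimum is over all estimators $\widetilde{X_1(k)}$ available to the adversary.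
   Context: $r$-states i.i.d. model. For each $n$ there are $n$ users, and data values lie in $\{0,1,\dots,r-1\}$. Let $$\mathcal{R}_{\mathbf{p}}=\{(x_1,\dots,x_{r-1})\in(0,1)^{r-1}: x_i>0\ (i=1,\dots,r-1),\ x_1+\cdots+x_{r-1}<1\}.$$ (Data) Vectors $\mathbf{P}_u=(P_u(1),\dots,P_u(r-1))$, $u=1,\dots,n$, are drawn independently from the density $f_{\mathbf{P}}$ on $\mathbb{R}^{r-1}$; put $P_u(0)=1-\sum_{i=1}^{r-1}P_u(i)$. Given $\mathbf{P}_1,\dots,\mathbf{P}_n$, the data $X_u(k)$, $k=1,2,\dots$, of user $u$ are i.i.d. with $P(X_u(k)=i)=P_u(i)$, independent across users. (Obfuscation) Independently of everything else, $R_1,\dots,R_n$ are i.i.d. $\mathrm{Uniform}[0,a_n]$, where $a_n\in(0,1]$ (consider $n$ large enough that $a_n\le 1$). Each $R_u$ is drawn once and kept fixed for all times. Given the $X$'s and $R$'s, independently over $u$ and $k$, $P(Z_u(k)=l\mid X_u(k)=i)=1-R_u$ if $l=i$ and $=\frac{R_u}{r-1}$ if $l\ne i$. Let $\mathbf{Z}_u=(Z_u(1),\dots,Z_u(m))^T$, where $m=m(n)$ is the number of observations per user (rounded to an integer). (Anonymization) $\Pi$ is a uniformly random permutation of $\{1,\dots,n\}$, independent of everything else, and $\mathbf{Y}=[\mathbf{Z}_{\Pi^{-1}(1)},\dots,\mathbf{Z}_{\Pi^{-1}(n)}]$ is the $m\times n$ matrix observed by the adversary. (Adversary) The adversary knows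 $\mathbf{P}_1,\dots,\mathbf{P}_n$ and $a_n$, but not $\Pi$ nor $R_1,\dots,R_n$; an estimator $\widetilde{X_1(k)}$ is a (measurable) function of $\mathbf{Y}$ and $(\mathbf{P}_1,\dots,\mathbf{P}_n)$ with values in $\{0,\dots,r-1\}$, possibly depending on $n$, $k$, $a_n$. *)

(* Defs.v *)
From HB Require Import structures.
From mathcomp Require Import all_boot all_order all_algebra.
From mathcomp Require Import fingroup perm.
From mathcomp Require Import all_classical all_reals all_analysis.

Set Implicit Arguments.
Unset Strict Implicit.
Unset Printing Implicit Defensive.

Import Order.TTheory GRing.Theory Num.Theory.
Import numFieldNormedType.Exports.

Local Open Scope classical_set_scope.
Local Open Scope ring_scope.

Section lebesgue_tuple.
Context {R : realType}.
Local Notation RR := (measurableTypeR R).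

Definition cons_pair d (p : RR * d.-tuple RR) : d.+1.-tuple RR :=
  [the d.+1.-tuple RR of p.1 :: p.2].

Lemma measurable_cons_pair d : measurable_fun setT (@cons_pair d).
Proof. exact: (@measurable_cons _ _ (RR * d.-tuple RR)%type RR fst d snd). Qed.

Definition uncons_pair d (t : d.+1.-tuple RR) : RR * d.-tuple RR :=
  (tnth t ord0, [tuple of behead t]).

Lemma measurable_uncons_pair d : measurable_fun setT (@uncons_pair d).
Proof.
apply/measurable_fun_pair; first exact: measurable_tnth.
exact: measurable_behead.
Qed.

Lemma cons_pairK d : cancel (@cons_pair d) (@uncons_pair d).
Proof. by move=> [x t]; congr pair; apply/val_inj. Qed.

Section step.
Variables (d : nat) (mu : {sigma_finite_measure set (d.-tuple RR) -> \bar R}).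

Definition lebesgue_cons : set (d.+1.-tuple RR) -> \bar R :=
  pushforward (@lebesgue_measure R \x mu)%E (@cons_pair d).

Let lebesgue_cons0 : lebesgue_cons set0 = 0%E.
Proof. by rewrite /lebesgue_cons /pushforward preimage_set0 measure0. Qed.

Let lebesgue_cons_ge0 A : (0 <= lebesgue_cons A)%E.
Proof. rewrite /lebesgue_cons /pushforward; exact: measure_ge0. Qed.

Let lebesgue_cons_sigma_additive : semi_sigma_additive lebesgue_cons.
Proof.
move=> F mF tF mUF; rewrite /lebesgue_cons /pushforward preimage_bigcup.
have mcons A : measurable A -> measurable (@cons_pair d @^-1` A).
  by move=> mA; rewrite -[X in measurable X]setTI; exact: measurable_cons_pair.
apply: measure_semi_sigma_additive.
- by move=> n; exact: mcons.
- apply/trivIsetP => /= i j _ _ ij; rewrite -preimage_setI.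
  by move/trivIsetP : tF => /(_ _ _ _ _ ij) ->//; rewrite preimage_set0.
- by rewrite -preimage_bigcup; exact: mcons.
Qed.

HB.instance Definition _ := isMeasure.Build _ _ _ lebesgue_cons
  lebesgue_cons0 lebesgue_cons_ge0 lebesgue_cons_sigma_additive.

Let lebesgue_cons_sigma_finite : sigma_finite setT lebesgue_cons.
Proof.
have /sigma_finiteP[F [TF ndF Foo]] := sigma_finiteT (@lebesgue_measure R).
have /sigma_finiteP[G [TG ndG Goo]] := sigma_finiteT mu.
exists (fun n => @uncons_pair d @^-1` (F n `*` G n)).
  rewrite -preimage_bigcup (_ : \bigcup_n _ = setT) ?preimage_setT//.
  apply/seteqP; split => // -[x y] _ /=.
  have [n _ Fnx] : (\bigcup_n F n) x by rewrite -TF.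
  have [k _ Gky] : (\bigcup_n G n) y by rewrite -TG.
  exists (maxn n k) => //; split => /=.
    by move: x Fnx; exact/subsetPset/ndF/leq_maxl.
  by move: y Gky; exact/subsetPset/ndG/leq_maxr.
move=> n; have [mF Fn] := Foo n; have [mG Gn] := Goo n; split.
  rewrite -[X in measurable X]setTI; apply: measurable_uncons_pair => //.
  exact: measurableX.
rewrite /lebesgue_cons /pushforward (_ : _ @^-1` _ = F n `*` G n).
  by rewrite product_measure1E// lte_mul_pinfty// ge0_fin_numE.
by apply/funext => x; rewrite /preimage/mkset cons_pairK.
Qed.

HB.instance Definition _ := Measure_isSigmaFinite.Build _ _ _ lebesgue_cons
  lebesgue_cons_sigma_finite.
End step.

(* Lebesgue measure on R^d, the Borel sigma-algebra on R^d being that of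
   d.-tuple R; lebesgue_tuple_box below gives its value on boxes. *)
Fixpoint lebesgue_tuple d : {sigma_finite_measure set (d.-tuple RR) -> \bar R} :=
  match d with
  | 0 => @dirac _ (0.-tuple RR) [tuple] R
  | d'.+1 => lebesgue_cons (lebesgue_tuple d')
  end.

Lemma lebesgue_tuple_box d (A : 'I_d -> set RR) :
  (forall i, measurable (A i)) ->
  lebesgue_tuple d [set t | forall i, A i (tnth t i)] =
  (\prod_(i < d) @lebesgue_measure R (A i))%E.
Proof.
elim: d A => [|d IHd] A mA.
  rewrite big_ord0 /= (_ : [set t | _] = setT) ?diracT//.
  by apply/seteqP; split => // t _ [].
rewrite big_ord_recl -IHd// /= /lebesgue_cons /pushforward.
have mB : measurable [set t : d.-tuple RR | forall i, A (lift ord0 i) (tnth t i)].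
  rewrite (_ : mkset _ = \bigcap_(i in [set: 'I_d])
    ((fun t : d.-tuple RR => tnth t i) @^-1` A (lift ord0 i))).
    apply: fin_bigcap_measurable => // i _.
    by rewrite -[X in measurable X]setTI; apply: measurable_tnth.
  by apply/seteqP; split => t h i; [move=> _|]; exact: h.
rewrite -product_measure1E//; congr (_ _).
apply/seteqP; split => -[x t] /=.
  by move=> h; split; [exact: (h ord0)|move=> i; have := h (lift ord0 i); rewrite tnthS].
by move=> [Ax At] i; case: (unliftP ord0 i) => [j|] ->; rewrite ?tnthS//; exact: At.
Qed.

End lebesgue_tuple.

Section probability_notions.
Context {R : realType} {d : measure_display} {T : measurableType d}.
Variable P : probability T R.

Definition preimage_family (I T' : Type) (S : set (set T')) (Y : I -> T -> T') :
    set (set T) :=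
  [set Y i @^-1` B | i in setT & B in S].

Definition mutual_indep (I : finType) (d' : measure_display)
    (T' : measurableType d') (Y : I -> T -> T') : Prop :=
  forall A : I -> set T', (forall i, measurable (A i)) ->
    P [set w | forall i, A i (Y i w)] = (\prod_i P (Y i @^-1` A i))%E.

Definition indep_sigma (G H : set (set T)) : Prop :=
  forall A B, G A -> H B -> P (A `&` B) = (P A * P B)%E.

(* g is a version of the conditional probability of E given the
   sigma-algebra G *)
Definition is_cond_prob (G : set (set T)) (E : set T) (g : T -> R) : Prop :=
  (forall B : set R, measurable B -> G (g @^-1` B)) /\
  (forall A, G A -> P (A `&` E) = (\int[P]_(w in A) (g w)%:E)%E).

End probability_notions.

Section model.
Context {R : realType}.

Definition simplex_interior (q : nat) : set (q.-tuple R) :=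
  [set p | (forall i, 0 < tnth p i < 1) /\ \sum_(i < q) tnth p i < 1].

(* The topology of R^q is only available on row vectors. *)
Definition continuous_tuple_on (q : nat) (D : set (q.-tuple R))
    (f : q.-tuple R -> R) : Prop :=
  let of_row (v : 'rV[R]_q) : q.-tuple R := [tuple v ord0 i | i < q] in
  {within of_row @^-1` D, continuous (f \o of_row)}.

Definition is_density (q : nat) (f : q.-tuple R -> R) : Prop :=
  [/\ measurable_fun setT f, forall p, 0 <= f p &
      (\int[lebesgue_tuple q]_p (f p)%:E = 1)%E].

(* A vector P_u has coordinates P_u(1), ..., P_u(r-1), stored at positions
   0, ..., r-2. *)
Definition state_prob (r : nat) (p : r.-1.-tuple R) (i : 'I_r) : R :=
  if val i is j.+1 then nth 0 p j else 1 - \sum_(j < r.-1) tnth p j.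

Definition obf_prob (r : nat) (rho : R) (i l : 'I_r) : R :=
  if l == i then 1 - rho else rho / r.-1%:R.

Context {d : measure_display} {T : measurableType d} {P : probability T R}.
Variables r n : nat.

(* Times are numbered from 0: X u k is the datum of user u at time k+1.
   Conditional laws of discrete families are given by their finite-dimensional
   distributions over all users and the first K times, for every K. *)
Record iid_model (f : r.-1.-tuple R -> R) (a : R)
    (Pv : 'I_n -> {RV P >-> r.-1.-tuple R}) (X : 'I_n -> nat -> T -> 'I_r)
    (Rv : 'I_n -> {RV P >-> R}) (Z : 'I_n -> nat -> T -> 'I_r)
    (Pi : T -> {perm 'I_n}) : Prop := {
  X_meas : forall u k i, measurable (X u k @^-1` [set i]) ;
  Z_meas : forall u k i, measurable (Z u k @^-1` [set i]) ;
  Pi_meas : forall s, measurable (Pi @^-1` [set s]) ;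
  Pv_indep : mutual_indep P Pv ;
  Pv_density : forall u A, measurable A ->
    distribution P (Pv u) A = (\int[lebesgue_tuple r.-1]_(p in A) (f p)%:E)%E ;
  X_law : forall (K : nat) (x : 'I_n -> 'I_K -> 'I_r),
    is_cond_prob P <<s preimage_family measurable Pv >>
      [set w | forall u (k : 'I_K), X u k w = x u k]
      (fun w => \prod_u \prod_(k < K) state_prob (Pv u w) (x u k)) ;
  Rv_indep : mutual_indep P Rv ;
  Rv_unif : exists a_gt0 : 0 < a, forall u A, measurable A ->
    distribution P (Rv u) A = uniform_prob a_gt0 A ;
  Rv_indep_data : indep_sigma P <<s preimage_family measurable Rv >>
    <<s preimage_family measurable Pv `|`
        preimage_family setT (fun uk : 'I_n * nat => X uk.1 uk.2) >> ;
  Z_law : forall (K : nat) (z : 'I_n -> 'I_K -> 'I_r),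
    is_cond_prob P
      <<s preimage_family measurable Pv `|`
          preimage_family setT (fun uk : 'I_n * nat => X uk.1 uk.2) `|`
          preimage_family measurable Rv >>
      [set w | forall u (k : 'I_K), Z u k w = z u k]
      (fun w => \prod_u \prod_(k < K) obf_prob (Rv u w) (X u k w) (z u k)) ;
  Pi_unif : forall s, P (Pi @^-1` [set s]) = (n`!%:R^-1)%:E ;
  Pi_indep : indep_sigma P <<s preimage_family setT (fun _ : unit => Pi) >>
    <<s preimage_family measurable Pv `|`
        preimage_family setT (fun uk : 'I_n * nat => X uk.1 uk.2) `|`
        preimage_family measurable Rv `|`
        preimage_family setT (fun uk : 'I_n * nat => Z uk.1 uk.2) >> }.

Definition observation (m : nat) (Z : 'I_n -> nat -> T -> 'I_r)
    (Pi : T -> {perm 'I_n}) (w : T) : 'M['I_r]_(m, n) :=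
  \matrix_(j < m, u < n) Z ((Pi w)^-1%g u) j w.

(* Observation matrices range over a finite set, so joint measurability of an
   estimator is measurability of each of its sections. *)
Definition estimators (m : nat) :
    set ('M['I_r]_(m, n) -> n.-tuple (r.-1.-tuple R) -> 'I_r) :=
  [set g | forall Y i, measurable [set p | g Y p = i]].

Definition min_error (m : nat) (Pv : 'I_n -> T -> r.-1.-tuple R)
    (X Z : 'I_n -> nat -> T -> 'I_r) (Pi : T -> {perm 'I_n})
    (u : 'I_n) (k : nat) : \bar R :=
  ereal_inf [set P [set w | g (observation m Z Pi w) [tuple Pv v w | v < n]
                            <> X u k w] | g in @estimators m].

End model.

Arguments simplex_interior {R} q _.

(* Main.v *)
Require Import Defs.
From HB Require Import structures.
From mathcomp Require Import all_boot all_order all_algebra.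
From mathcomp Require Import fingroup perm.
From mathcomp Require Import all_classical all_reals all_analysis.
From mathcomp Require Import measurable_realfun.
From mathcomp Require Import ring lra.

Set Implicit Arguments.
Unset Strict Implicit.
Unset Printing Implicit Defensive.

Import Order.TTheory GRing.Theory Num.Theory.
Import numFieldNormedType.Exports.

Local Open Scope classical_set_scope.
Local Open Scope ring_scope.

(* The adversary knows P_1 and looks for the column of Y whose empirical
   frequencies are within Delta = n^-(1/(r-1) + alpha/4) of P_1 in every
   coordinate, then outputs the k-th entry of that column.

   The column of user 1 passes this test with probability tending to 1: given
   P_1, Chebyshev's inequality puts the frequencies of X_1 within Delta/2 of
   P_1 up to an error 1/(m Delta^2), and by Markov's inequality at most
   m Delta/2 of the m entries are altered up to an error a/Delta, which is
   small because beta > alpha/4.  The column of another user u passes with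
   probability at most delta2 (2 Delta)^(r-1), whatever the fluctuations of
   Z_u: P_1 is independent of Z_u and its density is at most delta2, so that P_1
   rarely falls into the box around the frequencies of Z_u.  Summing over u costs
   a factor n, and n Delta^(r-1) still tends to 0.  Finally Z_1(k) = X_1(k) up to
   an error a. *)

(** * Chebyshev's inequality for letter counts under a finite product law *)

(** The product law of [m] letters is written as a finite sum, so that the bound can later be
    applied pointwise to a conditional law. The centred indicators [d (x k)] have mean zero, hence
    only the diagonal of the second moment survives, and each of its [m] terms is at most 1. *)
Lemma chebyshev_count (F : realFieldType) (J : finType) (m : nat) (q : J -> F)
    (i : J) (t : F) :
  (forall j, 0 <= q j) -> \sum_j q j = 1 -> 0 < t ->
  \sum_(x : {ffun 'I_m -> J} |
      t < `|#|[pred k | x k == i]|%:R - m%:R * q i|) \prod_k q (x k)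
    <= m%:R / t ^+ 2.
Proof.
move=> q0 q1 t0; pose d y : F := (y == i)%:R - q i.
have d0 : \sum_y q y * d y = 0.
  under eq_bigr do rewrite mulrBr; rewrite sumrB -mulr_suml q1 mul1r.
  rewrite (bigD1 i)//= eqxx mulr1 big1 ?addr0 ?subrr// => y /negbTE ->.
  by rewrite mulr0.
have qi1 : q i <= 1 by rewrite -q1 (bigD1 i)//= lerDl sumr_ge0.
have d1 y : d y * d y <= 1.
  by rewrite /d; have := q0 i; case: (y == i) => /=; nra.
have prod1 : \sum_(x : {ffun 'I_m -> J}) \prod_k q (x k) = 1.
  by rewrite -(bigA_distr_bigA (fun=> q)) big1.
have cov (k l : 'I_m) :
    \sum_(x : {ffun 'I_m -> J}) (\prod_h q (x h)) * (d (x k) * d (x l))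
      <= (k == l)%:R.
  have [<-|kl] := eqVneq k l.
    rewrite [leRHS](_ : _ = 1)// -[leRHS]prod1; apply: ler_sum => x _.
    by rewrite ler_piMr// prodr_ge0.
  (* [G] inserts [d] at the positions [k] and [l] only; the sum over words then factorizes over
     positions, and position [k] contributes the mean [d0]. *)
  pose G h y := q y * ((if h == k then d y else 1) * (if h == l then d y else 1)).
  rewrite (eq_bigr (fun x : {ffun 'I_m -> J} => \prod_h G h (x h))); last first.
    move=> x _; rewrite /G big_split big_split/=; congr (_ * (_ * _)).
      by rewrite -big_mkcond big_pred1_eq.
    by rewrite -big_mkcond big_pred1_eq.
  rewrite -(bigA_distr_bigA G) (bigD1 k)//= (_ : \sum_j G k j = 0) ?mul0r//.
  by rewrite -[RHS]d0; apply: eq_bigr => y _; rewrite /G eqxx (negbTE kl) mulr1.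
have var : \sum_(x : {ffun 'I_m -> J})
    (\prod_k q (x k)) * (\sum_k d (x k)) ^+ 2 <= m%:R.
  rewrite (eq_bigr (fun x : {ffun 'I_m -> J} => \sum_k \sum_l
      (\prod_h q (x h)) * (d (x k) * d (x l)))); last first.
    move=> x _; rewrite expr2 mulr_suml mulr_sumr; apply: eq_bigr => k _.
    by rewrite mulr_sumr mulr_sumr.
  rewrite exchange_big/= -[leRHS](_ : \sum_(k < m) 1 = _); last first.
    by rewrite big_const_ord iter_addr_0.
  apply: ler_sum => k _; rewrite exchange_big/=.
  apply: le_trans (ler_sum _ (fun l _ => cov k l)) _.
  rewrite (bigD1 k)//= eqxx big1 ?addr0// => l.
  by rewrite eq_sym => /negbTE ->.
(* Markov's inequality for the square: on the event, [t ^+ 2] is below the squared deviation, and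
   the remaining terms are nonnegative. *)
rewrite ler_pdivlMr ?exprn_gt0// mulr_suml; apply: le_trans var.
rewrite [leLHS]big_mkcond/=; apply: ler_sum => x _.
have -> : \sum_k d (x k) = #|[pred k | x k == i]|%:R - m%:R * q i.
  rewrite /d sumrB; congr (_ - _).
    by rewrite -natr_sum -sum1_card [in RHS]big_mkcond.
  by rewrite big_const_ord iter_addr_0 mulr_natl.
case: ifPn => [tx|_]; last by rewrite mulr_ge0 ?sqr_ge0 ?prodr_ge0.
rewrite ler_wpM2l ?prodr_ge0// -[leRHS]real_normK ?num_real//.
by rewrite ler_sqr ?nnegrE// ltW.
Qed.

(** * Finite-valued random variables and conditional laws *)

Section finite_valued.
Context {R : realType} {d : measure_display} {T : measurableType d}.

Definition fin_measurable (J : Type) (W : T -> J) :=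
  forall x, measurable (W @^-1` [set x]).

Lemma fin_measurable_preimage (J : finType) (W : T -> J) (A : set J) :
  fin_measurable W -> measurable (W @^-1` A).
Proof.
move=> mW; rewrite (_ : _ @^-1` _ = \bigcup_(x in A) (W @^-1` [set x])).
  by apply: fin_bigcup_measurable => // x _; exact: mW.
by apply/seteqP; split => [w ?|w [x Ax /= ->]//]; exists (W w).
Qed.

Lemma fin_measurable_comp (J J' : finType) (W : T -> J) (g : J -> J') :
  fin_measurable W -> fin_measurable (g \o W).
Proof. by move=> mW x; rewrite comp_preimage; exact: fin_measurable_preimage. Qed.

Lemma fin_measurable_pair (J J' : Type) (W : T -> J) (W' : T -> J') :
  fin_measurable W -> fin_measurable W' ->
  fin_measurable (fun w => (W w, W' w)).
Proof.
move=> mW mW' [x x'].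
rewrite (_ : _ @^-1` _ = W @^-1` [set x] `&` W' @^-1` [set x']).
  exact: measurableI.
by apply/seteqP; split => w /= [-> ->].
Qed.

Lemma fin_measurable_ffun (I : finType) (J : Type) (W : I -> T -> J) :
  (forall i, fin_measurable (W i)) ->
  fin_measurable (fun w => [ffun i => W i w]).
Proof.
move=> mW x.
rewrite (_ : _ @^-1` _ = \bigcap_(i in [set: I]) (W i @^-1` [set x i])).
  by apply: fin_bigcap_measurable => // i _; exact: mW.
apply/seteqP; split => w /= => [<- i _ /=|h]; first by rewrite ffunE.
by apply/ffunP => i; rewrite ffunE; exact: h.
Qed.

(** Splitting over the finitely many values of [W] reduces joint measurability to that of the
    sections. This serves events that involve both a discrete row and a vector [Pv u]. *)
Lemma measurable_fin_section (J : finType) (W : T -> J) d' (T' : measurableType d')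
    (Y : T -> T') (D : J -> set T') :
  fin_measurable W -> measurable_fun setT Y -> (forall x, measurable (D x)) ->
  measurable [set w | D (W w) (Y w)].
Proof.
move=> mW mY mD; rewrite (_ : mkset _ =
    \bigcup_(x in [set: J]) (W @^-1` [set x] `&` Y @^-1` D x)).
  apply: fin_bigcup_measurable => // x _; apply: measurableI; first exact: mW.
  by rewrite -[X in measurable X]setTI; exact: mY.
by apply/seteqP; split => [w h|w [x _ [/= <-]]//]; exists (W w).
Qed.

Variable mu : {measure set T -> \bar R}.

Lemma measure_fin_partition (J : finType) (W : T -> J) (Q : pred J) A :
  fin_measurable W -> measurable A ->
  mu (A `&` [set w | Q (W w)]) = (\sum_(x | Q x) mu (A `&` W @^-1` [set x]))%E.
Proof.
move=> mW mA; rewrite -big_enum/=.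
have -> : [set w | Q (W w)] = [set w | W w \in enum Q].
  by apply/seteqP; split => w /=; rewrite mem_enum.
elim: (enum Q) (enum_uniq Q) => [_|x s IHs /= /andP[xs us]].
  rewrite big_nil (_ : _ `&` _ = set0) ?measure0//.
  by apply/seteqP; split => w // [].
rewrite big_cons -IHs// -measureU//.
- congr (mu _); rewrite -setIUr; congr (_ `&` _); apply/seteqP; split => w /=.
    by rewrite inE => /orP[/eqP|]; [left|right].
  by rewrite inE => -[->|->]; rewrite ?eqxx ?orbT.
- by apply: measurableI => //; exact: mW.
- by apply: measurableI => //; exact: fin_measurable_preimage [set x | x \in s] mW.
- by apply/seteqP; split => w //= -[[_ /= ->] [_ ws]]; rewrite ws in xs.
Qed.

Lemma measure_fin_total (J : finType) (W : T -> J) A :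
  fin_measurable W -> measurable A ->
  mu A = (\sum_x mu (A `&` W @^-1` [set x]))%E.
Proof.
move=> mW mA; rewrite -(measure_fin_partition xpredT)//; congr (mu _).
by apply/seteqP; split => [w|w []].
Qed.

Lemma measure_bigsetU_le (J : finType) (Q : pred J) (F : J -> set T) :
  (forall j, Q j -> measurable (F j)) ->
  (mu [set w | exists2 j, Q j & F j w] <= \sum_(j | Q j) mu (F j))%E.
Proof.
move=> mF; rewrite -big_enum/=.
have -> : [set w | exists2 j, Q j & F j w] =
    [set w | exists2 j, j \in enum Q & F j w].
  apply/seteqP; split => w /= [j jQ Fj]; exists j => //.
    by rewrite mem_enum.
  by rewrite mem_enum in jQ.
have mFs (s : seq J) : {subset s <= enum Q} -> forall j, j \in s -> measurable (F j).
  by move=> sQ j /sQ; rewrite mem_enum; exact: mF.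
suff: forall s, {subset s <= enum Q} ->
    measurable [set w | exists2 j, j \in s & F j w] /\
    (mu [set w | exists2 j, j \in s & F j w] <= \sum_(j <- s) mu (F j))%E.
  by move=> /(_ (enum Q)) [].
elim => [_|j s IHs sQ].
  rewrite big_nil (_ : mkset _ = set0) ?measure0//.
  by apply/seteqP; split => w // [].
have [mU le] : measurable [set w | exists2 i, i \in s & F i w] /\
    (mu [set w | exists2 i, i \in s & F i w] <= \sum_(i <- s) mu (F i))%E.
  by apply: IHs => i si; apply: sQ; rewrite inE si orbT.
have mFj : measurable (F j) by exact: mFs _ sQ _ (mem_head _ _).
rewrite (_ : mkset _ = F j `|` [set w | exists2 i, i \in s & F i w]).
  split; first exact: measurableU.
  rewrite big_cons; apply: le_trans (measureU2 _ _ _) _ => //; exact: leeD2l.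
apply/seteqP; split => w /=.
  by move=> [i]; rewrite inE => /orP[/eqP ->|si Fi]; [left|right; exists i].
move=> [Fj|[i si Fi]]; [exists j|exists i] => //; first exact: mem_head.
by rewrite inE si orbT.
Qed.

End finite_valued.

(** * Marginals of conditional product laws *)

Section product_marginal.
Context {R : realType} {d : measure_display} {T : measurableType d}.
Variables (P : {measure set T -> \bar R}) (G : set (set T)).
Variables (I J : finType) (W : I -> T -> J) (K : T -> I -> J -> R).
Hypothesis GW : G `<=` measurable.
Hypothesis mW : forall i, fin_measurable (W i).
Hypothesis K0 : forall w i y, 0 <= K w i y.
Hypothesis mK : forall i y, measurable_fun setT (fun w => K w i y).
Hypothesis lawW : forall (x : {ffun I -> J}) A, G A ->
  P (A `&` [set w | forall i, W i w = x i]) =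
  (\int[P]_(w in A) (\prod_i K w i (x i))%:E)%E.

(** The hypothesis gives the probability of single configurations. Summing it over the
    configurations in the box [family S] and distributing the product over the sums yields the
    claim; nonnegativity of [K] lets sum and integral be exchanged. *)
Lemma product_law_marginal (S : I -> pred J) A : G A ->
  P (A `&` [set w | forall i, S i (W i w)]) =
  (\int[P]_(w in A) (\prod_i \sum_(y | S i y) K w i y)%:E)%E.
Proof.
move=> GA; have mA := GW GA; pose WW w := [ffun i => W i w].
have mWW : fin_measurable WW by exact: fin_measurable_ffun.
rewrite (_ : mkset _ = [set w | WW w \in family S]); last first.
  apply/seteqP; split => w /=; first by move=> h; apply/familyP => i; rewrite ffunE; exact: h.
  by move/familyP => h i; have := h i; rewrite ffunE.
rewrite (@measure_fin_partition _ _ _ _ _ WW (mem (family S)))//.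
transitivity (\int[P]_(w in A)
    \sum_(x <- enum (family S)) (\prod_i K w i (x i))%:E)%E; last first.
  by apply: eq_integral => w _; rewrite sumEFin big_enum/= bigA_distr_big_dep.
rewrite ge0_integral_sum//; last 2 first.
- move=> x; apply/measurable_EFinP; apply: measurable_funTS.
  by apply: measurable_prod => i _; exact: mK.
- by move=> x w _; rewrite lee_fin prodr_ge0.
rewrite big_enum/=; apply: eq_bigr => x _; rewrite -lawW//; congr (P (_ `&` _)).
apply/seteqP; split => w /=; first by move=> <- i; rewrite ffunE.
by move=> h; apply/ffunP => i; rewrite ffunE; exact: h.
Qed.

End product_marginal.

(** * Integration of a variable over an independent event *)

Section indep_integral.
Context {R : realType} {d : measure_display} {T : measurableType d}.
Variable P : probability T R.

Lemma integral_mrestr_ge0 (A : set T) (mA : measurable A) (h : T -> \bar R) :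
  measurable_fun setT h -> (forall w, 0 <= h w)%E ->
  (\int[mrestr P mA]_w h w = \int[P]_(w in A) h w)%E.
Proof.
move=> mh h0; have mAC := measurableC mA.
rewrite -(setUv A) ge0_integral_setU//; last 2 first.
- by rewrite setUv.
- by apply/disj_setPS; rewrite setICr.
rewrite [X in (_ + X)%E](_ : _ = 0%E) ?adde0.
  apply: eq_measure_integral => B mB BA /=; rewrite /mrestr setIidl//.
apply: null_set_integral => //; first exact: measurable_funTS.
by rewrite /= /mrestr setICl measure0.
Qed.

(** By independence, the image under [h] of [P] restricted to [A] is [P A] times the image of [P];
    both sides integrate the same function of the value of [h] against these two measures. *)
Lemma indep_integral (A : set T) (h : T -> R) :
  measurable A -> measurable_fun setT h -> (forall w, 0 <= h w) ->
  (forall B, measurable B -> P (A `&` h @^-1` B) = (P A * P (h @^-1` B))%E) ->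
  (\int[P]_(w in A) (h w)%:E = P A * \int[P]_w (h w)%:E)%E.
Proof.
move=> mA mh h0 indep.
have mhE : measurable_fun setT (fun w => (h w)%:E) by exact/measurable_EFinP.
rewrite -(@integral_mrestr_ge0 A mA)//.
(* [abs] is the positive part: it agrees with the identity on the values of [h] and is nonnegative
   on the whole line, as the change of variables requires. *)
pose abs (y : R) := (Num.max y 0)%:E.
have mabs : measurable_fun setT abs.
  by apply/measurable_EFinP; exact: measurable_maxr.
have abs0 y : (0 <= abs y)%E by rewrite lee_fin le_max lexx orbT.
have habs w : (h w)%:E = abs (h w) by rewrite /abs max_l.
have push (nu : {measure set T -> \bar R}) :
    (\int[nu]_w (h w)%:E = \int[pushforward nu h]_y abs y)%E.
  rewrite (ge0_integral_pushforward mh)// preimage_setT.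
  by apply: eq_integral => w _; rewrite habs.
rewrite !push.
have PA : P A = (NngNum (fine_ge0 (measure_ge0 P A)))%:num%:E.
  by rewrite fineK ?fin_num_measure.
pose nu : {measure set R -> \bar R} :=
  measure_function_pushforward__canonical__measure_function_Measure P mh.
rewrite PA -(@ge0_integral_mscale _ _ _ nu setT)//.
apply: eq_measure_integral => B mB _.
by rewrite /= /mscale -PA /nu/= /pushforward /mrestr setIC indep.
Qed.

End indep_integral.

(** * The kernels of data and obfuscation *)

Section kernels.
Context {R : realType}.
Implicit Types q r : nat.

Lemma measurable_sum_tnth q :
  measurable_fun setT (fun p : q.-tuple R => \sum_(i < q) tnth p i).
Proof. by apply: measurable_sum => i; exact: measurable_tnth. Qed.

Lemma measurable_simplex_interior q : measurable (@simplex_interior R q).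
Proof.
rewrite (_ : simplex_interior q =
  (\bigcap_(i in [set: 'I_q]) ((@tnth q R ^~ i) @^-1` `]0, 1[)) `&`
  ((fun p : q.-tuple R => \sum_(i < q) tnth p i) @^-1` `]-oo, 1[)).
  apply: measurableI; last first.
    rewrite -[X in measurable X]setTI; exact: measurable_sum_tnth.
  apply: fin_bigcap_measurable => // i _.
  by rewrite -[X in measurable X]setTI; exact: measurable_tnth.
apply/seteqP; split => p /= -[h p1]; split; rewrite /= ?in_itv//=.
- by move=> i _; rewrite /= in_itv/=; exact: h.
- by move=> i; have := h i Logic.I; rewrite /= in_itv.
Qed.

(* The data vectors lie in the simplex and the noise levels in [0, a] only
   almost surely; clipping them makes all conditional probabilities below
   nonnegative everywhere. The zero vector encodes the point mass at state 0. *)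
Definition simplex_clip q (p : q.-tuple R) : q.-tuple R :=
  if `[< simplex_interior q p >] then p else [tuple of nseq q 0].

Definition itv_clip (a x : R) : R := Num.max 0 (Num.min x a).

Lemma measurable_simplex_clip q : measurable_fun setT (@simplex_clip q).
Proof.
apply: measurable_fun_ifT => //; apply: (measurable_fun_bool true).
rewrite setTI (_ : _ @^-1` _ = @simplex_interior R q).
  exact: measurable_simplex_interior.
by apply/seteqP; split => p /= /asboolP.
Qed.

Lemma measurable_itv_clip a : measurable_fun setT (itv_clip a).
Proof. by apply: measurable_maxr => //; exact: measurable_minr. Qed.

Lemma itv_clip_id a x : 0 <= x <= a -> itv_clip a x = x.
Proof. by case/andP => x0 x1; rewrite /itv_clip min_l// max_r. Qed.

Lemma itv_clip_itv a x : 0 <= a -> 0 <= itv_clip a x <= a.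
Proof. by move=> a0; rewrite /itv_clip le_max lexx ge_max a0 ge_min lexx orbT. Qed.

Lemma state_prob_lift q (p : q.-tuple R) (j : 'I_q) :
  state_prob (r := q.+1) p (lift ord0 j) = tnth p j.
Proof. by rewrite /state_prob/= (tnth_nth 0). Qed.

Lemma state_prob0 q (p : q.-tuple R) :
  state_prob (r := q.+1) p ord0 = 1 - \sum_(j < q) tnth p j.
Proof. by []. Qed.

Lemma sum_state_prob q (p : q.-tuple R) : \sum_(i < q.+1) state_prob (r := q.+1) p i = 1.
Proof.
rewrite big_ord_recl state_prob0.
by rewrite (eq_bigr _ (fun j _ => state_prob_lift p j)) subrK.
Qed.

Lemma state_prob_clip_ge0 q (p : q.-tuple R) (i : 'I_q.+1) :
  0 <= state_prob (r := q.+1) (simplex_clip p) i.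
Proof.
case: (unliftP ord0 i) => [j|] ->.
  rewrite (state_prob_lift (simplex_clip p)) /simplex_clip; case: asboolP => [[h _]|_].
    by case/andP: (h j) => /ltW.
  by rewrite tnth_nseq.
rewrite state_prob0 subr_ge0 /simplex_clip; case: asboolP => [[_ /ltW]//|_].
by rewrite big1// => j _; rewrite tnth_nseq.
Qed.

Lemma measurable_state_prob q (i : 'I_q.+1) :
  measurable_fun setT (fun p : q.-tuple R => state_prob (r := q.+1) p i).
Proof.
case: (unliftP ord0 i) => [j|] ->.
  by rewrite (eq_fun (fun p => state_prob_lift p j)); exact: measurable_tnth.
under eq_fun do rewrite state_prob0.
by apply: measurable_funB => //; exact: measurable_sum_tnth.
Qed.

Lemma obf_prob_ge0 r (rho : R) (i l : 'I_r) :
  0 <= rho <= 1 -> 0 <= obf_prob rho i l.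
Proof.
by case/andP => rho0 rho1; rewrite /obf_prob; case: ifP; rewrite ?subr_ge0// divr_ge0.
Qed.

Lemma sum_obf_prob_neq q (rho : R) (i : 'I_q.+1) : (0 < q)%N ->
  \sum_(l | l != i) obf_prob rho i l = rho.
Proof.
move=> q0; rewrite (eq_bigr (fun=> rho / q%:R)); last first.
  by move=> l /negbTE li; rewrite /obf_prob li.
rewrite sumr_const cardC1 card_ord/= -[LHS]mulr_natr divfK// pnatr_eq0.
by rewrite -lt0n.
Qed.

Lemma sum_obf_prob q (rho : R) (i : 'I_q.+1) : (0 < q)%N ->
  \sum_l obf_prob rho i l = 1.
Proof.
by move=> q0; rewrite (bigD1 i)//= sum_obf_prob_neq// /obf_prob eqxx subrK.
Qed.

Lemma measurable_obf_prob r (i l : 'I_r) :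
  measurable_fun setT (fun rho : R => obf_prob rho i l).
Proof.
rewrite /obf_prob; case: (l == i); first exact: measurable_funB.
exact: measurable_funM.
Qed.

End kernels.

(** * Null sets, generated sigma-algebras and products of sums *)

Section off_null.
Context {R : realType} {d : measure_display} {T : measurableType d}.

Lemma integral_eq_off_null (mu : {measure set T -> \bar R}) (A N : set T)
    (f g : T -> \bar R) :
  measurable A -> measurable N -> mu N = 0%E ->
  measurable_fun setT f -> measurable_fun setT g ->
  (forall w, ~ N w -> f w = g w) ->
  (\int[mu]_(w in A) f w = \int[mu]_(w in A) g w)%E.
Proof.
move=> mA mN N0 mf mg fg; apply: ae_eq_integral => //;
  [exact: measurable_funTS..|].
exists N; split => // w /= /not_implyP[_ fgw]; apply: contrapT => /fg.
exact: fgw.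
Qed.

End off_null.

Section sigma_algebras.
Context {R : realType} {d : measure_display} {T : measurableType d}.

Lemma sigma_algebra_sub_measurable (G : set (set T)) :
  G `<=` measurable -> <<s G >> `<=` measurable.
Proof. by move=> GM; apply: smallest_sub => //; exact: sigma_algebra_measurable. Qed.

Lemma preimage_family_measurable (I : Type) d' (T' : measurableType d')
    (Y : I -> T -> T') : (forall i, measurable_fun setT (Y i)) ->
  preimage_family measurable Y `<=` measurable.
Proof. by move=> mY _ [i _ [B mB <-]]; rewrite -[X in measurable X]setTI; exact: mY. Qed.

Lemma preimage_family_fin_measurable (I : Type) (J : finType) (Y : I -> T -> J) :
  (forall i, fin_measurable (Y i)) -> preimage_family setT Y `<=` measurable.
Proof. by move=> mY _ [i _ [B _ <-]]; exact: fin_measurable_preimage. Qed.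

End sigma_algebras.

Section product_of_sums.
Context {R : comPzRingType} {n K : nat} {J : finType}.
Variables (F : 'I_n -> 'I_K -> J -> R).
Hypothesis F1 : forall u k, \sum_y F u k y = 1.

(** The implication leaves the users other than [u] unconstrained, and an unconstrained factor sums
    to 1. With a product law this extracts the law of one row. *)
Lemma prod_sum_row u (x : 'I_K -> J) :
  \prod_v \prod_k (\sum_(y | (v == u) ==> (y == x k)) F v k y) =
  \prod_k F u k (x k).
Proof.
rewrite (bigD1 u)//= [X in _ * X]big1 ?mulr1; last first.
  by move=> v /negbTE vu; rewrite big1// => k _; rewrite vu/= F1.
by apply: eq_bigr => k _; rewrite eqxx/= big_pred1_eq.
Qed.

Lemma prod_sum_entry u k (S : pred J) :
  \prod_v \prod_l (\sum_(y | (v == u) && (l == k) ==> S y) F v l y) =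
  \sum_(y | S y) F u k y.
Proof.
rewrite (bigD1 u)//= [X in _ * X]big1 ?mulr1; last first.
  by move=> v /negbTE vu; rewrite big1// => l _; rewrite vu/= F1.
rewrite (bigD1 k)//= [X in _ * X]big1 ?mulr1; last first.
  by move=> l /negbTE lk; rewrite lk andbF/= F1.
by rewrite !eqxx.
Qed.

End product_of_sums.

(** * One instance of the model *)

Section model_laws.
Context {R : realType} {d : measure_display} {T : measurableType d}.
Context {P : probability T R}.
Variables (q n : nat) (f : q.-tuple R -> R) (a : R).
Variables (Pv : 'I_n -> {RV P >-> q.-tuple R}) (X : 'I_n -> nat -> T -> 'I_q.+1).
Variables (Rv : 'I_n -> {RV P >-> R}) (Z : 'I_n -> nat -> T -> 'I_q.+1).
Variable Pi : T -> {perm 'I_n}.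
Hypothesis q0 : (0 < q)%N.
Hypothesis a1 : a <= 1.
Hypothesis f_supp : forall p, ~ simplex_interior q p -> f p = 0.
Hypothesis model : iid_model (r := q.+1) f a Pv X Rv Z Pi.

Let GP : set (set T) := <<s preimage_family measurable Pv >>.
Let GZ : set (set T) := <<s preimage_family measurable Pv `|`
  preimage_family setT (fun uk : 'I_n * nat => X uk.1 uk.2) `|`
  preimage_family measurable Rv >>.

Let mPv u : measurable_fun setT (Pv u : T -> q.-tuple R).
Proof. exact: measurable_funP. Qed.

Let mRv u : measurable_fun setT (Rv u : T -> R).
Proof. exact: measurable_funP. Qed.

Let mX u k : fin_measurable (X u k).
Proof. exact: (X_meas model u k). Qed.

Let mZ u k : fin_measurable (Z u k).
Proof. exact: (Z_meas model u k). Qed.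

Let GPm : GP `<=` measurable.
Proof. exact/sigma_algebra_sub_measurable/preimage_family_measurable. Qed.

Let GZm : GZ `<=` measurable.
Proof.
apply: sigma_algebra_sub_measurable => A [[|]|].
- exact: preimage_family_measurable.
- by apply: preimage_family_fin_measurable => uk; exact: mX.
- exact: preimage_family_measurable.
Qed.

Lemma Pv_off_simplex u : P [set w | ~ simplex_interior q (Pv u w)] = 0%E.
Proof.
have mS := measurableC (@measurable_simplex_interior R q).
have := Pv_density model u mS; rewrite /distribution/= /pushforward => ->.
by rewrite integral0_eq// => p /f_supp ->.
Qed.

Lemma Rv_off_itv u : P [set w | ~ (0 <= Rv u w <= a)] = 0%E.
Proof.
have mS : measurable (~` `[0, a] : set R) by apply: measurableC.
have [a0 /(_ u _ mS)] := Rv_unif model.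
rewrite /distribution/= /pushforward /uniform_prob.
rewrite integral0_eq; last first.
  move=> x /= nx.
  by rewrite /uniform_pdf; move/negP: nx; rewrite in_itv/= => /negbTE ->.
move=> <-; congr (P _); apply/seteqP; split => w /=; by rewrite in_itv.
Qed.

Let a_ge0 : 0 <= a.
Proof. by have [/ltW a0 _] := Rv_unif model. Qed.

Let clip01 x : 0 <= itv_clip a x <= 1.
Proof.
by have /andP[-> /le_trans/(_ a1)] := itv_clip_itv x a_ge0.
Qed.

(** Null events off which the clipped kernels agree with those of the model. The dummy condition
    [true] gives them the shape of the union bound [measure_bigsetU_le]. *)
Let NP := [set w | exists2 u, true & ~ simplex_interior q (Pv u w)].
Let NR := [set w | exists2 u, true & ~ (0 <= Rv u w <= a)].

Let mNPu u : measurable [set w | ~ simplex_interior q (Pv u w)].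
Proof.
by have := mPv u measurableT (measurableC (@measurable_simplex_interior R q)); rewrite setTI.
Qed.

Let mNRu u : measurable [set w | ~ (0 <= Rv u w <= a)].
Proof.
rewrite (_ : mkset _ = Rv u @^-1` (~` `[0, a])).
  have mI : measurable (~` `[0, a] : set R) by apply: measurableC.
  by have := mRv u measurableT mI; rewrite setTI.
by apply/seteqP; split => w /=; rewrite in_itv.
Qed.

Let mexists (F : 'I_n -> set T) : (forall u, measurable (F u)) ->
  measurable [set w | exists2 u, true & F u w].
Proof.
move=> mF; rewrite (_ : mkset _ = \bigcup_(u in [set: 'I_n]) F u).
  exact: fin_bigcup_measurable.
by apply/seteqP; split => w /= [u _ Fu]; exists u.
Qed.

Let null_exists (F : 'I_n -> set T) : (forall u, measurable (F u)) ->
  (forall u, P (F u) = 0%E) -> P [set w | exists2 u, true & F u w] = 0%E.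
Proof.
move=> mF F0; apply/eqP; rewrite eq_le measure_ge0 andbT.
have := @measure_bigsetU_le _ _ _ P _ xpredT F (fun u _ => mF u).
rewrite big1 => [|u _]; last exact: F0.
by [].
Qed.

(** * Conditional laws of rows and entries *)

(** [X_law] covers single configurations. Clipping alters its integrand only on [NP] and makes it
    nonnegative everywhere, after which [product_law_marginal] applies with users and times merged
    into one index. *)
Lemma X_marginal K (S : 'I_n -> 'I_K -> pred 'I_q.+1) A : GP A ->
  P (A `&` [set w | forall u k, S u k (X u k w)]) =
  (\int[P]_(w in A) (\prod_u \prod_(k < K)
     \sum_(y | S u k y) state_prob (r := q.+1) (simplex_clip (Pv u w)) y)%:E)%E.
Proof.
move=> GA; pose I : finType := ('I_n * 'I_K)%type.
pose W (i : I) := X i.1 i.2.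
pose kern w (i : I) y := state_prob (r := q.+1) (simplex_clip (Pv i.1 w)) y.
have mkern i y : measurable_fun setT (fun w => kern w i y).
  apply: (measurableT_comp (measurable_state_prob y)).
  exact: (measurableT_comp (@measurable_simplex_clip R q)).
have law (x : {ffun I -> 'I_q.+1}) B : GP B ->
    P (B `&` [set w | forall i, W i w = x i]) =
    (\int[P]_(w in B) (\prod_i kern w i (x i))%:E)%E.
  move=> GB; have [_ /(_ _ GB)] := X_law model (fun u k => x (u, k)).
  rewrite (_ : [set w | forall u (k : 'I_K), _] = [set w | forall i, W i w = x i]); last first.
    by apply/seteqP; split => w /= h; [case=> u k; exact: h|move=> u k; exact: (h (u, k))].
  move=> ->; apply: (@integral_eq_off_null _ _ _ _ _ NP).
  - exact: GPm.
  - exact: mexists.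
  - by apply: null_exists => // u; exact: Pv_off_simplex.
  - apply/measurable_EFinP; apply: measurable_prod => u _.
    apply: measurable_prod => k _.
    exact: (measurableT_comp (measurable_state_prob _)).
  - by apply/measurable_EFinP; apply: measurable_prod.
  move=> w NPw; rewrite pair_bigA/=; congr _%:E; apply: eq_bigr => -[u k] _ /=.
  rewrite /kern /simplex_clip; case: asboolP => // nS; exfalso; apply: NPw.
  by exists u.
have mW i : fin_measurable (W i) by exact: mX.
have kern0 w i y : 0 <= kern w i y by exact: state_prob_clip_ge0.
have := product_law_marginal GPm mW kern0 mkern law (fun i => S i.1 i.2) GA.
rewrite (_ : [set w | forall i : I, _] = [set w | forall u k, S u k (X u k w)]); last first.
  by apply/seteqP; split => w /= h; [move=> u k; exact: (h (u, k))|case=> u k; exact: h].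
move=> ->; apply: eq_integral => w _; congr _%:E.
by rewrite (pair_bigA _ (fun u k => \sum_(y | S u k y) _)).
Qed.

(** The same argument with [Z_law] and the null event [NR]; here the kernel depends on [w] through
    the noise level and also through the true data. *)
Lemma Z_marginal K (S : 'I_n -> 'I_K -> pred 'I_q.+1) A : GZ A ->
  P (A `&` [set w | forall u k, S u k (Z u k w)]) =
  (\int[P]_(w in A) (\prod_u \prod_(k < K)
     \sum_(y | S u k y) obf_prob (itv_clip a (Rv u w)) (X u k w) y)%:E)%E.
Proof.
move=> GA; pose I : finType := ('I_n * 'I_K)%type.
pose W (i : I) := Z i.1 i.2.
pose kern w (i : I) y := obf_prob (itv_clip a (Rv i.1 w)) (X i.1 i.2 w) y.
have mobf (rho : T -> R) u k y : measurable_fun setT rho ->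
    measurable_fun setT (fun w => obf_prob (rho w) (X u k w) y).
  move=> mrho; rewrite /obf_prob; apply: measurable_fun_ifT => //.
  - apply: (measurable_fun_bool true).
    rewrite setTI (_ : _ @^-1` _ = X u k @^-1` [set y]); first exact: mX.
    by apply/seteqP; split => w /=; [move/eqP|move=> ->; rewrite eqxx].
  - exact: measurable_funB.
  - exact: measurable_funM.
have mkern i y : measurable_fun setT (fun w => kern w i y).
  by apply: mobf; exact: (measurableT_comp (@measurable_itv_clip R a)).
have law (x : {ffun I -> 'I_q.+1}) B : GZ B ->
    P (B `&` [set w | forall i, W i w = x i]) =
    (\int[P]_(w in B) (\prod_i kern w i (x i))%:E)%E.
  move=> GB; have [_ /(_ _ GB)] := Z_law model (fun u k => x (u, k)).
  rewrite (_ : [set w | forall u (k : 'I_K), _] = [set w | forall i, W i w = x i]); last first.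
    by apply/seteqP; split => w /= h; [case=> u k; exact: h|move=> u k; exact: (h (u, k))].
  move=> ->; apply: (@integral_eq_off_null _ _ _ _ _ NR).
  - exact: GZm.
  - exact: mexists.
  - by apply: null_exists => // u; exact: Rv_off_itv.
  - apply/measurable_EFinP; apply: measurable_prod => u _.
    by apply: measurable_prod => k _; exact: mobf.
  - by apply/measurable_EFinP; apply: measurable_prod.
  move=> w NRw; rewrite pair_bigA/=; congr _%:E; apply: eq_bigr => -[u k] _ /=.
  rewrite /kern/= itv_clip_id//; apply: contrapT => h; apply: NRw; exists u => //.
have mW i : fin_measurable (W i) by exact: mZ.
have kern0 w i y : 0 <= kern w i y by rewrite obf_prob_ge0 ?clip01.
have := product_law_marginal GZm mW kern0 mkern law (fun i => S i.1 i.2) GA.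
rewrite (_ : [set w | forall i : I, _] = [set w | forall u k, S u k (Z u k w)]); last first.
  by apply/seteqP; split => w /= h; [move=> u k; exact: (h (u, k))|case=> u k; exact: h].
move=> ->; apply: eq_integral => w _; congr _%:E.
by rewrite (pair_bigA _ (fun u k => \sum_(y | S u k y) _)).
Qed.

Lemma X_row_marginal u K (x : 'I_K -> 'I_q.+1) A : GP A ->
  P (A `&` [set w | forall k : 'I_K, X u k w = x k]) =
  (\int[P]_(w in A) (\prod_(k < K)
     state_prob (r := q.+1) (simplex_clip (Pv u w)) (x k))%:E)%E.
Proof.
move=> GA; have := X_marginal (fun v k y => (v == u) ==> (y == x k)) GA.
rewrite (_ : [set w | forall v (k : 'I_K), _] =
    [set w | forall k : 'I_K, X u k w = x k]); last first.
  apply/seteqP; split => w /= h.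
    by move=> k; have := h u k; rewrite eqxx => /eqP.
  by move=> v k; apply/implyP => /eqP ->; rewrite h.
move=> ->; apply: eq_integral => w _; congr _%:E.
rewrite (prod_sum_row (F := fun v _ y => state_prob (r := q.+1) (simplex_clip (Pv v w)) y))//.
by move=> v k; exact: sum_state_prob.
Qed.

Lemma Z_row_marginal u K (z : 'I_K -> 'I_q.+1) A : GZ A ->
  P (A `&` [set w | forall k : 'I_K, Z u k w = z k]) =
  (\int[P]_(w in A) (\prod_(k < K)
     obf_prob (itv_clip a (Rv u w)) (X u k w) (z k))%:E)%E.
Proof.
move=> GA; have := Z_marginal (fun v k y => (v == u) ==> (y == z k)) GA.
rewrite (_ : [set w | forall v (k : 'I_K), _] =
    [set w | forall k : 'I_K, Z u k w = z k]); last first.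
  apply/seteqP; split => w /= h.
    by move=> k; have := h u k; rewrite eqxx => /eqP.
  by move=> v k; apply/implyP => /eqP ->; rewrite h.
move=> ->; apply: eq_integral => w _; congr _%:E.
rewrite (prod_sum_row (F := fun v (k : 'I_K) y => obf_prob (itv_clip a (Rv v w)) (X v k w) y))//.
by move=> v k; exact: sum_obf_prob.
Qed.

Lemma GZ_X_entry u k i : GZ (X u k @^-1` [set i]).
Proof.
apply: sub_sigma_algebra; left; right.
by exists (u, k) => //; exists [set i].
Qed.

Lemma measurable_Z_neq_X u k : measurable [set w | Z u k w <> X u k w].
Proof.
exact: (fin_measurable_preimage [set p | p.1 <> p.2]
  (fin_measurable_pair (@mZ u k) (@mX u k))).
Qed.

(** Given the data and the noise levels, an entry is altered with probability [Rv u], which is at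
    most [a] almost surely. *)
Lemma Z_neq_X_le u k : (P [set w | Z u k w <> X u k w] <= a%:E)%E.
Proof.
have mZX := measurable_Z_neq_X u k.
rewrite (_ : mkset _ = [set w | Z u k w != X u k w]) in mZX *; last first.
  by apply/seteqP; split => w /= /eqP.
rewrite (measure_fin_total P (@mX u k))//.
have -> : a%:E = (\sum_i a%:E * P (setT `&` X u k @^-1` [set i]))%E.
  rewrite -ge0_sume_distrr//.
  rewrite -(@measure_fin_total _ _ _ P _ (X u k) setT)// -[LHS]mule1; congr (_ * _)%E; exact/esym/probability_setT.
apply: lee_sum => i _; rewrite setTI.
(* On [X u k = i] the event constrains [Z] alone, which is needed because the sets in [Z_marginal]
   do not depend on [w]. The horizon [k.+1] makes time [k] the last one, [ord_max]. *)
have -> : [set w | Z u k w != X u k w] `&` X u k @^-1` [set i] =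
    X u k @^-1` [set i] `&` [set w | forall v (l : 'I_k.+1),
      ((v == u) && (l == ord_max)) ==> (Z v l w != i)].
  apply/seteqP; split => w /= [].
    by move=> ZX Xi; split => // v l; apply/implyP => /andP[/eqP -> /eqP ->]; rewrite -Xi.
  move=> Xi /(_ u ord_max); rewrite !eqxx/= => Zi; split => //.
  by rewrite Xi.
have /= -> := @Z_marginal k.+1 (fun v l y => ((v == u) && (l == ord_max)) ==> (y != i))
  _ (GZ_X_entry u k i).
rewrite -integral_cst; last exact: mX.
rewrite [leLHS](_ : _ = \int[P]_(w in X u k @^-1` [set i]) (itv_clip a (Rv u w))%:E)%E; last first.
  apply: eq_integral => w; rewrite inE/= => Xi; congr _%:E.
  rewrite (prod_sum_entry (F := fun v (k : 'I_k.+1) y => obf_prob (itv_clip a (Rv v w)) (X v k w) y))/=.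
    by rewrite Xi sum_obf_prob_neq.
  by move=> v l; exact: sum_obf_prob.
apply: ge0_le_integral => //.
- exact: mX.
- by move=> w _; rewrite lee_fin; case/andP: (itv_clip_itv (Rv u w) a_ge0).
- apply/measurable_EFinP; apply: measurable_funTS.
  exact: (measurableT_comp (@measurable_itv_clip R a)).
- by move=> w _; rewrite lee_fin; case/andP: (itv_clip_itv (Rv u w) a_ge0).
Qed.

(** * Concentration of the counts in one row *)

Lemma measurable_Pv_preimage u (B : set (q.-tuple R)) :
  measurable B -> measurable (Pv u @^-1` B).
Proof. by move=> mB; have := mPv u measurableT mB; rewrite setTI. Qed.

Lemma GP_Pv_preimage u (B : set (q.-tuple R)) :
  measurable B -> GP (Pv u @^-1` B).
Proof. by move=> mB; apply: sub_sigma_algebra; exists u => //; exists B. Qed.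

Lemma measurable_count_dev K (x : 'I_K -> 'I_q.+1) (j : 'I_q) (t : R) :
  measurable [set p : q.-tuple R |
    t < `|#|[pred k | x k == lift ord0 j]|%:R - K%:R * tnth p j|].
Proof.
pose g (p : q.-tuple R) : R :=
  `|#|[pred k | x k == lift ord0 j]|%:R - K%:R * tnth p j|.
have mg : measurable_fun setT g.
  apply: measurableT_comp => //; apply: measurable_funB => //.
  by apply: measurable_funM => //; exact: measurable_tnth.
rewrite (_ : mkset _ = g @^-1` `]t, +oo[).
  by rewrite -[X in measurable X]setTI; exact: mg.
by apply/seteqP; split => p /=; rewrite in_itv/= andbT.
Qed.

Lemma fin_measurable_row u K (Y : 'I_n -> nat -> T -> 'I_q.+1) :
  (forall u k, fin_measurable (Y u k)) ->
  fin_measurable (fun w => [ffun k : 'I_K => Y u k w]).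
Proof. by move=> mY; apply: fin_measurable_ffun => k; exact: mY. Qed.

Lemma measurable_count_X_deviation u K (j : 'I_q) (t : R) :
  measurable [set w | t < `|#|[pred k : 'I_K | X u k w == lift ord0 j]|%:R -
    K%:R * tnth (simplex_clip (Pv u w)) j|].
Proof.
pose D (x : {ffun 'I_K -> 'I_q.+1}) : set (q.-tuple R) :=
  [set p | t < `|#|[pred k | x k == lift ord0 j]|%:R - K%:R * tnth p j|].
rewrite (_ : mkset _ =
    [set w | D [ffun k : 'I_K => X u k w] (simplex_clip (Pv u w))]).
  apply: measurable_fin_section; first exact: fin_measurable_row.
    exact: (measurableT_comp (@measurable_simplex_clip R q)).
  by move=> x; exact: measurable_count_dev.
by apply/seteqP; split => w; rewrite /D/=; congr (t < `|_%:R - _|);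
  apply: eq_card => k; rewrite !inE ffunE.
Qed.

Lemma measurable_count_Z_neq_X u K (t : R) :
  measurable [set w | t < #|[pred k : 'I_K | Z u k w != X u k w]|%:R].
Proof.
rewrite (_ : mkset _ = (fun w => ([ffun k : 'I_K => Z u k w], [ffun k : 'I_K => X u k w]))
    @^-1` [set zx : {ffun 'I_K -> 'I_q.+1} * {ffun 'I_K -> 'I_q.+1} | t < #|[pred k | zx.1 k != zx.2 k]|%:R]).
  by apply: fin_measurable_preimage; apply: fin_measurable_pair; exact: fin_measurable_row.
by apply/seteqP; split => w /=; congr (t < _%:R); apply: eq_card => k; rewrite !inE !ffunE.
Qed.

(** The event involves both the row and [Pv u]. Once the row is fixed to [x] it becomes the event
    [D x] on [Pv u] alone, so the conditional law of the row applies; the sum over [x] of the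
    integrands is, at each [w], the left side of [chebyshev_count]. *)
Lemma count_X_deviation u K (j : 'I_q) (t : R) : 0 < t ->
  (P [set w | (t < `|#|[pred k : 'I_K | X u k w == lift ord0 j]|%:R -
                    K%:R * tnth (simplex_clip (Pv u w)) j|)%R]
     <= (K%:R / t ^+ 2)%:E)%E.
Proof.
move=> t0; pose D (x : {ffun 'I_K -> 'I_q.+1}) : set (q.-tuple R) :=
  @simplex_clip R q @^-1` [set p | t < `|#|[pred k | x k == lift ord0 j]|%:R -
    K%:R * tnth p j|].
have mD x : measurable (D x).
  rewrite -[X in measurable X]setTI; apply: measurable_simplex_clip => //.
  exact: measurable_count_dev.
pose XX w := [ffun k : 'I_K => X u k w].
have mXX : fin_measurable XX by exact: fin_measurable_row.
pose E x := (Pv u @^-1` D x) `&` XX @^-1` [set x].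
have mB := measurable_count_X_deviation u K j t; set B := mkset _ in mB *.
have BE x : B `&` XX @^-1` [set x] = E x.
  apply/seteqP; split => w /= [+ Xx]; rewrite /B /D/= -Xx => h; split => //;
    move: h; congr (t < `|_%:R - _|); apply: eq_card => k; by rewrite !inE ffunE.
rewrite (measure_fin_total P mXX)//.
pose g (x : {ffun 'I_K -> 'I_q.+1}) w : R := \prod_(k < K) state_prob (r := q.+1) (simplex_clip (Pv u w)) (x k).
have g0 x w : 0 <= g x w by apply: prodr_ge0 => k _; exact: state_prob_clip_ge0.
have mg x : measurable_fun setT (g x).
  apply: measurable_prod => k _.
  apply: (measurableT_comp (measurable_state_prob (x k))).
  exact: (measurableT_comp (@measurable_simplex_clip R q)).
(* Extending the integrands by 0 puts all the integrals on the whole space, so that the sum over [x]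
   can be moved inside. *)
pose h (x : {ffun 'I_K -> 'I_q.+1}) : T -> \bar R :=
  (EFin \o g x) \_ (Pv u @^-1` D x).
rewrite (eq_bigr (fun x => \int[P]_w h x w)%E); last first.
  move=> x _; rewrite BE /h -integral_mkcond -X_row_marginal; last first.
    by apply: GP_Pv_preimage.
  congr (P (_ `&` _)); apply/seteqP; split => w /=; first by move=> <- k; rewrite ffunE.
  by move=> Xx; apply/ffunP => k; rewrite ffunE.
have h0 x w : (0 <= h x w)%E.
  by apply: erestrict_ge0 => y _; rewrite /= lee_fin.
have mh x : measurable_fun setT (h x).
  apply/(measurable_restrictT _ _).1; first exact: measurable_Pv_preimage.
  by apply: measurable_funTS; exact/measurable_EFinP.
rewrite -ge0_integral_sum//.
rewrite -[leRHS]mule1 -(probability_setT P) -integral_cst//.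
apply: ge0_le_integral => //.
- by move=> w _; apply: sume_ge0.
- exact: emeasurable_sum.
move=> w _.
have := @chebyshev_count R 'I_q.+1 K
  (fun i => state_prob (r := q.+1) (simplex_clip (Pv u w)) i) (lift ord0 j) t.
move=> /(_ (fun i => state_prob_clip_ge0 _ i) (sum_state_prob _) t0).
rewrite (state_prob_lift (simplex_clip (Pv u w))) -lee_fin; apply: le_trans.
rewrite -sumEFin [leRHS]big_mkcond/=; apply: lee_sum => x _.
rewrite /h patchE (_ : (w \in _) = (t < `|#|[pred k | x k == lift ord0 j]|%:R -
    K%:R * tnth (simplex_clip (Pv u w)) j|)); first by case: ifP.
by apply/idP/idP => [/set_mem//|?]; exact/mem_set.
Qed.

(** Markov's inequality: the entries of a row are dependent through the common [Rv u], but by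
    linearity the expected number of altered entries is at most [K%:R * a]. *)
Lemma count_Z_neq_X u K (t : R) : 0 < t ->
  (P [set w | (t < #|[pred k : 'I_K | Z u k w != X u k w]|%:R)%R]
     <= (K%:R * a / t)%:E)%E.
Proof.
move=> t0; pose E (k : 'I_K) := [set w | Z u k w <> X u k w].
have mE k : measurable (E k) by exact: measurable_Z_neq_X.
pose N w : R := \sum_(k < K) \1_(E k) w.
have NE w : N w = #|[pred k : 'I_K | Z u k w != X u k w]|%:R.
  rewrite /N -sum1_card natr_sum [RHS]big_mkcond/=; apply: eq_bigr => k _.
  rewrite indicE inE; case: eqP => ZX; last by rewrite mem_set.
  by rewrite memNset//=; apply.
have mN : measurable_fun setT N by apply: measurable_sum => k; exact: measurable_indic.
have N0 w : 0 <= N w by apply: sumr_ge0.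
have mB := measurable_count_Z_neq_X u K t.
have BE : [set w | t < #|[pred k : 'I_K | Z u k w != X u k w]|%:R] = [set w | t < N w].
  by apply/seteqP; split => w /=; rewrite NE.
rewrite BE in mB *.
rewrite EFinM -lee_pdivrMr ?invr_gt0// invrK.
have -> : (K%:R * a)%:E = (\sum_(k < K) a%:E)%E.
  by rewrite sumEFin sumr_const card_ord mulr_natl.
apply: le_trans (_ : (\int[P]_w (N w)%:E <= _)%E); last first.
  rewrite (eq_integral (fun w => \sum_(k < K) (\1_(E k) w)%:E)%E); last first.
    by move=> w _; rewrite sumEFin.
  rewrite ge0_integral_sum//; last first.
    by move=> k; apply/measurable_EFinP; exact: measurable_indic.
  by apply: lee_sum => k _; rewrite integral_indic// setIT; exact: Z_neq_X_le.
rewrite muleC -integral_cst//.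
apply: (@le_trans _ _ (\int[P]_(w in [set w | (t < N w)%R]) (N w)%:E)%E).
  apply: ge0_le_integral => //.
  - by move=> w _; rewrite lee_fin ltW.
  - by apply/measurable_EFinP; exact: measurable_funTS.
  - by move=> w /= /ltW tN; rewrite lee_fin.
apply: ge0_subset_integral => //; first exact/measurable_EFinP.
by move=> w _; rewrite lee_fin.
Qed.

(** * Rows of other users against an independent vector *)

Lemma Pv_indep2 u v (B C : set (q.-tuple R)) : u != v ->
  measurable B -> measurable C ->
  P (Pv v @^-1` B `&` Pv u @^-1` C) = (P (Pv v @^-1` B) * P (Pv u @^-1` C))%E.
Proof.
move=> uv mB mC; pose A i := if i == v then B else if i == u then C else setT.
have mA i : measurable (A i) by rewrite /A; case: ifP => // _; case: ifP.
have := Pv_indep model mA.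
rewrite (bigD1 v)//= (bigD1 u)//= big1 ?mule1; last first.
  move=> i /andP[/negbTE iv /negbTE iu].
  by rewrite /A iv iu preimage_setT probability_setT.
rewrite /A !eqxx (negbTE uv) => <-; congr (P _); apply/seteqP; split => w /=.
  move=> [Bw Cw] i; case: ifPn => [/eqP -> //|_].
  by case: ifPn => [/eqP ->|].
by move=> h; split; [have := h v|have := h u]; rewrite ?(negbTE uv) eqxx.
Qed.

(* The constant c is P (Z_u = z), as B = setT shows: P_v is independent of the
   rows of the other users. *)
Lemma row_independence u v K (z : 'I_K -> 'I_q.+1) : u != v ->
  exists c : \bar R, forall B : set (q.-tuple R), measurable B ->
    P (Pv v @^-1` B `&` [set w | forall k : 'I_K, Z u k w = z k]) =
    (P (Pv v @^-1` B) * c)%E.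
Proof.
move=> uv.
pose g (x : {ffun 'I_K -> 'I_q.+1}) w : R :=
  \prod_(k < K) state_prob (r := q.+1) (simplex_clip (Pv u w)) (x k).
pose h (x : {ffun 'I_K -> 'I_q.+1}) w : R :=
  \prod_(k < K) obf_prob (itv_clip a (Rv u w)) (x k) (z k).
have g0 x w : 0 <= g x w by apply: prodr_ge0 => k _; exact: state_prob_clip_ge0.
have h0 x w : 0 <= h x w.
  by apply: prodr_ge0 => k _; apply: obf_prob_ge0; exact: clip01.
(* The law of total probability over the true row [x]: the first factor is the probability that the
   data of [u] equal [x], the second the mean probability that [x] is obfuscated into [z]. *)
exists (\sum_(x : {ffun 'I_K -> 'I_q.+1})
  (\int[P]_w (g x w)%:E) * (\int[P]_w (h x w)%:E))%E => B mB.
have mXX : fin_measurable (fun w => [ffun k : 'I_K => X u k w]).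
  exact: fin_measurable_row.
have mZz : measurable [set w | forall k : 'I_K, Z u k w = z k].
  rewrite (_ : mkset _ = (fun w => [ffun k : 'I_K => Z u k w]) @^-1`
      [set [ffun k => z k]]); first exact: fin_measurable_row.
  apply/seteqP; split => w /= => [h'|/ffunP h' k]; first by apply/ffunP => k; rewrite !ffunE.
  by have := h' k; rewrite !ffunE.
have mA := measurable_Pv_preimage v mB.
rewrite (measure_fin_total P mXX); last exact: measurableI.
rewrite ge0_sume_distrr; last first.
  by move=> x _; apply: mule_ge0; apply: integral_ge0 => w _; rewrite lee_fin.
apply: eq_bigr => x _.
pose Ex := [set w | forall k : 'I_K, X u k w = x k].
have -> : (fun w => [ffun k : 'I_K => X u k w]) @^-1` [set x] = Ex.
  rewrite /Ex; apply/seteqP; split => w /= => [<- k|h']; first by rewrite ffunE.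
  by apply/ffunP => k; rewrite ffunE.
rewrite setIAC.
(* The event on [Pv v] and the true row is placed in the sigma-algebra independent of the noise, and
   then in the larger one on which [Z_law] conditions. *)
pose GPX : set (set T) := <<s preimage_family measurable Pv `|`
  preimage_family setT (fun uk : 'I_n * nat => X uk.1 uk.2) >>.
have GPXE : GPX (Pv v @^-1` B `&` Ex).
  apply: (@measurableI _ (g_sigma_algebraType _)).
    by apply: sub_sigma_algebra; left; exists v => //; exists B.
  rewrite (_ : Ex = \bigcap_(k in [set: 'I_K]) (X u k @^-1` [set x k])).
    apply: (@fin_bigcap_measurable _ (g_sigma_algebraType _)) => // k _.
    by apply: sub_sigma_algebra; right; exists (u, nat_of_ord k) => //; exists [set x k].
  by apply/seteqP; split => w h' k //=; exact: h'.
have GZE : GZ (Pv v @^-1` B `&` Ex).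
  by apply: (sub_sigma_algebra2 _ GPXE); exact: subsetUl.
have mE := GZm GZE.
apply: etrans (@Z_row_marginal u K z _ GZE) _.
transitivity (\int[P]_(w in Pv v @^-1` B `&` Ex) (h x w)%:E)%E.
  apply: eq_integral => w; rewrite inE/= => -[_ Xx].
  by congr _%:E; apply: eq_bigr => k _; rewrite Xx.
(* [psi] and [phi] exhibit [g x] and [h x] as functions of [Pv u] and of [Rv u] alone, which is the
   form in which independence is used. *)
pose psi (p : q.-tuple R) : R :=
  \prod_(k < K) state_prob (r := q.+1) (simplex_clip p) (x k).
pose phi (rho : R) : R := \prod_(k < K) obf_prob (itv_clip a rho) (x k) (z k).
have mpsi : measurable_fun setT psi.
  apply: measurable_prod => k _.
  exact: (measurableT_comp (measurable_state_prob (x k)) (@measurable_simplex_clip R q)).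
have mphi : measurable_fun setT phi.
  apply: measurable_prod => k _.
  exact: (measurableT_comp (@measurable_obf_prob R _ (x k) (z k))
    (@measurable_itv_clip R a)).
(* Independence enters twice: the noise of [u] splits off from vectors and data, then [Pv u] splits
   off from [Pv v]. *)
rewrite indep_integral//.
- rewrite muleA; congr (_ * _)%E.
  have -> := @X_row_marginal u K x _ (GP_Pv_preimage v mB).
  apply: (@indep_integral _ _ _ P _ (g x)) => //.
    exact: (measurableT_comp mpsi (mPv u)).
  move=> C mC; apply: (Pv_indep2 uv mB (C := psi @^-1` C)).
  by rewrite -[X in measurable X]setTI; exact: mpsi.
- exact: (measurableT_comp mphi (mRv u)).
- move=> C mC; rewrite setIC muleC; apply: (Rv_indep_data model) GPXE.
  apply: sub_sigma_algebra; exists u => //; exists (phi @^-1` C) => //.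
  by rewrite -[X in measurable X]setTI; exact: mphi.
Qed.

Lemma measurable_box (y : 'I_q -> R) (Delta : R) :
  measurable [set p : q.-tuple R | forall i, `|y i - tnth p i| <= Delta].
Proof.
rewrite (_ : mkset _ = \bigcap_(i in [set: 'I_q])
    ((@tnth q R ^~ i) @^-1` `[y i - Delta, y i + Delta])).
  apply: fin_bigcap_measurable => // i _.
  by rewrite -[X in measurable X]setTI; exact: measurable_tnth.
apply/seteqP; split => p h i; have := h i; rewrite /= ?in_itv/= ?ler_distlC.
  by move=> + _ => /andP[? ?]; apply/andP; lra.
by move=> /(_ Logic.I) /andP[? ?]; apply/andP; lra.
Qed.

(** The density is at most [delta2] and the box is a cube of side [2 * Delta]. *)
Lemma Pv_box u (y : 'I_q -> R) (delta2 Delta : R) : (0 <= Delta) ->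
  measurable_fun setT f ->
  (forall p, 0 <= f p <= delta2) ->
  (P (Pv u @^-1` [set p | forall i, (`|y i - tnth p i| <= Delta)%R])
    <= (delta2 * (2 * Delta) ^+ q)%:E)%E.
Proof.
move=> D0 mf f2; set B := mkset _.
have BE : B = [set p | forall i, `[y i - Delta, y i + Delta]%classic (tnth p i)].
  apply/seteqP; split => p /= h i; have := h i;
    rewrite ?in_itv/= ?ler_distlC => /andP[? ?]; apply/andP; lra.
have mB : measurable B by exact: measurable_box.
have := Pv_density model u mB; rewrite /distribution/= /pushforward => ->.
apply: (@le_trans _ _ (\int[lebesgue_tuple q]_(p in B) delta2%:E)%E).
  apply: ge0_le_integral => //.
  - by move=> p _; rewrite lee_fin; case/andP: (f2 p).
  - by apply/measurable_EFinP; exact: measurable_funTS.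
  - by move=> p _; rewrite lee_fin; case/andP: (f2 p).
rewrite integral_cst// EFinM; apply: lee_wpmul2l.
  by rewrite lee_fin; case/andP: (f2 [tuple of nseq q 0]) => /le_trans; apply.
rewrite BE [leLHS](@lebesgue_tuple_box R q
  (fun i => `[y i - Delta, y i + Delta]%classic))// (eq_bigr (fun=> (2 * Delta)%:E)); last first.
  (* A degenerate side forces [Delta = 0], and its length 0 is still [2 * Delta]. *)
  move=> i _; rewrite lebesgue_measure_itv/= lte_fin; case: ifPn => yD.
    by rewrite -EFinB; congr _%:E; lra.
  by congr _%:E; lra.
by rewrite prodEFin prodr_const card_ord.
Qed.

(** * The matching estimator and its error *)

(** Position [j] of [p] holds the probability of state [j + 1], that is [lift ord0 j]. The test is
    boolean so that [pick] can search for a column passing it. *)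
Definition freq_close K (Delta : R) (z : 'I_K -> 'I_q.+1) (p : q.-tuple R) :=
  [forall j : 'I_q,
    `|#|[pred k | z k == lift ord0 j]|%:R / K%:R - tnth p j| <= Delta].

Lemma eq_freq_close K (Delta : R) (z z' : 'I_K -> 'I_q.+1) p :
  z =1 z' -> freq_close Delta z p = freq_close Delta z' p.
Proof.
move=> zz'; apply: eq_forallb => j; congr (`|_%:R / _ - _| <= _).
by apply: eq_card => k; rewrite !inE zz'.
Qed.

Lemma measurable_freq_close K (Delta : R) (z : 'I_K -> 'I_q.+1) :
  measurable [set p | freq_close Delta z p].
Proof.
rewrite (_ : mkset _ = [set p : q.-tuple R | forall j,
    `|#|[pred k | z k == lift ord0 j]|%:R / K%:R - tnth p j| <= Delta]).
  exact: measurable_box.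
by apply/seteqP; split => p /= /forallP.
Qed.

Lemma measurable_row_freq_close u v K (Delta : R) :
  measurable [set w | freq_close Delta (fun k : 'I_K => Z u k w) (Pv v w)].
Proof.
have mZZ : fin_measurable (fun w => [ffun k : 'I_K => Z u k w]).
  exact: fin_measurable_row.
rewrite (_ : mkset _ = [set w | freq_close Delta [ffun k : 'I_K => Z u k w] (Pv v w)]).
  exact: (measurable_fin_section mZZ (mPv v)
    (fun z : {ffun _} => measurable_freq_close Delta z)).
by apply/seteqP; split => w /=; rewrite (@eq_freq_close _ _ [ffun=> _] (fun k => Z u k w))// => k;
  rewrite ffunE.
Qed.

(** Once the row of [u] is fixed to [z], the test asks [Pv v] to lie in a fixed box. By
    [row_independence] the box bound holds given each [z], hence also after averaging over [z]. *)
Lemma other_row_freq_close u v K (delta2 Delta : R) : u != v -> 0 <= Delta ->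
  measurable_fun setT f -> (forall p, 0 <= f p <= delta2) ->
  (P [set w | freq_close Delta (fun k : 'I_K => Z u k w) (Pv v w)]
    <= (delta2 * (2 * Delta) ^+ q)%:E)%E.
Proof.
move=> uv D0 mf f2; set b := (delta2 * _).
pose ZZ w := [ffun k : 'I_K => Z u k w].
have mZZ : fin_measurable ZZ by exact: fin_measurable_row.
have mF := measurable_row_freq_close u v K Delta.
rewrite (measure_fin_total P mZZ mF).
have b0 : 0 <= b.
  rewrite mulr_ge0// ?exprn_ge0// ?mulr_ge0//.
  by case/andP: (f2 [tuple of nseq q 0]) => /le_trans; apply.
have -> : b%:E = (\sum_z b%:E * P (setT `&` ZZ @^-1` [set z]))%E.
  rewrite -ge0_sume_distrr// -(measure_fin_total P mZZ)//.
  by rewrite -[LHS]mule1; congr (_ * _)%E; exact/esym/probability_setT.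
apply: lee_sum => z _; rewrite setTI.
have ZzE : ZZ @^-1` [set z] = [set w | forall k : 'I_K, Z u k w = z k].
  apply/seteqP; split => w /= => [zE k|h]; first by rewrite -zE ffunE.
  by apply/ffunP => k; rewrite ffunE.
have [c Hc] := row_independence z uv.
pose C := [set p : q.-tuple R | freq_close Delta z p].
have mC : measurable C by exact: measurable_freq_close.
have -> : [set w | freq_close Delta (fun k : 'I_K => Z u k w) (Pv v w)]
    `&` ZZ @^-1` [set z] = Pv v @^-1` C `&` [set w | forall k : 'I_K, Z u k w = z k].
  rewrite -ZzE; apply/seteqP; split => w /= -[h /= zw]; split => //; move: h;
    rewrite /C/= -(eq_freq_close _ (z := fun k : 'I_K => Z u k w))// => k;
    by rewrite -zw ffunE.
rewrite ZzE; have <- : c = P [set w | forall k : 'I_K, Z u k w = z k].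
  have := Hc setT measurableT.
  by rewrite preimage_setT setTI probability_setT mul1e => ->.
apply: (@le_trans _ _ (P (Pv v @^-1` C) * c)%E).
  by rewrite -(Hc _ mC).
apply: lee_wpmul2r.
  have := Hc setT measurableT.
  by rewrite preimage_setT setTI probability_setT mul1e => <-; exact: measure_ge0.
rewrite (_ : C = [set p : q.-tuple R | forall j,
    (`|#|[pred k | z k == lift ord0 j]|%:R / K%:R - tnth p j| <= Delta)%R]).
  exact: Pv_box.
by apply/seteqP; split => p /= /forallP.
Qed.

(** The default column [u0] is reached only if no column passes the test, a case that the error
    bound counts as a failure. *)
Definition match_estimator m (u0 : 'I_n) (k : 'I_m) (Delta : R)
    (Y : 'M['I_q.+1]_(m, n)) (p : n.-tuple (q.-tuple R)) : 'I_q.+1 :=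
  Y k (odflt u0 [pick u | freq_close Delta (fun l => Y l u) (tnth p u0)]).

(** For a fixed matrix the output depends on [p] only through the finite vector of test outcomes,
    each of which is a measurable event. *)
Lemma match_estimatorP m (u0 : 'I_n) (k : 'I_m) (Delta : R) :
  estimators (match_estimator u0 k Delta).
Proof.
move=> Y i; pose B (p : n.-tuple (q.-tuple R)) :=
  [ffun u => freq_close Delta (fun l => Y l u) (tnth p u0)].
have mB : fin_measurable B.
  apply: fin_measurable_ffun => u b.
  have m1 : measurable [set p : n.-tuple (q.-tuple R) |
      freq_close Delta (fun l => Y l u) (tnth p u0)].
    rewrite -[X in measurable X]setTI.
    exact: (measurable_tnth u0 measurableT (measurable_freq_close Delta _)).
  case: b => //.
  rewrite (_ : _ @^-1` _ = ~` [set p : n.-tuple (q.-tuple R) |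
      freq_close Delta (fun l => Y l u) (tnth p u0)]); first exact: measurableC.
  by apply/seteqP; split => p /=; [move=> -> | move/negP/negbTE].
rewrite (_ : mkset _ = B @^-1` [set b : {ffun 'I_n -> bool} |
    Y k (odflt u0 [pick u | b u]) = i]); first exact: fin_measurable_preimage.
have BE p : [pick u | B p u] =
    [pick u | freq_close Delta (fun l => Y l u) (tnth p u0)].
  by apply: eq_pick => u; rewrite ffunE.
by apply/seteqP; split => p /=; rewrite /match_estimator BE.
Qed.

Lemma fin_measurable_observation m : fin_measurable (observation m Z Pi).
Proof.
pose W w := (Pi w, [ffun uk : 'I_n * 'I_m => Z uk.1 uk.2 w]).
rewrite (_ : observation m Z Pi = (fun s : {perm 'I_n} * {ffun 'I_n * 'I_m -> 'I_q.+1} =>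
    \matrix_(j < m, u < n) s.2 ((s.1^-1)%g u, j)) \o W).
  apply: fin_measurable_comp; apply: fin_measurable_pair.
    exact: (Pi_meas model).
  by apply: fin_measurable_ffun => uk; exact: mZ.
by apply/funext => w; apply/matrixP => j u; rewrite !mxE ffunE.
Qed.

Lemma fin_measurable_estimate m (g : 'M['I_q.+1]_(m, n) -> n.-tuple (q.-tuple R) -> 'I_q.+1) :
  estimators (r := q.+1) g ->
  fin_measurable (fun w => g (observation m Z Pi w) [tuple Pv v w | v < n]).
Proof.
move=> mg i.
have mPt : measurable_fun setT (fun w => [tuple Pv v w | v < n]).
  apply/measurable_fun_tnthP => v.
  rewrite (_ : _ \o _ = Pv v)//.
  by apply/funext => w /=; rewrite tnth_mktuple.
exact: (measurable_fin_section (fin_measurable_observation (m := m)) mPt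
  (fun Y => mg Y i)).
Qed.

(** Altering one entry moves the count of a given state by at most 1. *)
Lemma count_mismatch K (x z : 'I_K -> 'I_q.+1) i :
  `|#|[pred k | z k == i]|%:R - #|[pred k | x k == i]|%:R|
    <= #|[pred k | z k != x k]|%:R :> R.
Proof.
have cnt (y : 'I_K -> 'I_q.+1) :
    #|[pred k | y k == i]|%:R = \sum_(k < K) (y k == i)%:R :> R.
  rewrite -sum1_card natr_sum [LHS]big_mkcond/=; apply: eq_bigr => k _.
  by rewrite inE; case: (y k == i).
rewrite !cnt -sumrB -sum1_card natr_sum [leRHS]big_mkcond/=.
apply: le_trans (ler_norm_sum _ _ _) _; apply: ler_sum => k _; rewrite inE.
have [->|zx] := eqVneq (z k) (x k); first by rewrite subrr normr0.
by case: (z k == i); case: (x k == i) => /=; rewrite ?subrr ?normr0 ?subr0 ?sub0r ?normrN ?normr1.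
Qed.

(** After multiplication by [m] the tolerance is [m * Delta]; half of it is spent on altered entries
    and half on the fluctuation of the true data. *)
Lemma own_row_freq_close u m (Delta : R) w : (0 < m)%N ->
  simplex_interior q (Pv u w) ->
  #|[pred k : 'I_m | Z u k w != X u k w]|%:R <= m%:R * Delta / 2 ->
  (forall j : 'I_q, `|#|[pred k : 'I_m | X u k w == lift ord0 j]|%:R -
    m%:R * tnth (simplex_clip (Pv u w)) j| <= m%:R * Delta / 2) ->
  freq_close Delta (fun k : 'I_m => Z u k w) (Pv u w).
Proof.
move=> m0 Pw neq dev; apply/forallP => j.
have m0' : 0 < m%:R :> R by rewrite ltr0n.
have := dev j; rewrite /simplex_clip (asboolT Pw) => devj.
rewrite -(ler_pM2l m0') -{1}(ger0_norm (ltW m0')) -normrM mulrBr.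
rewrite [m%:R * (_ / _)]mulrC divfK ?gt_eqF//.
have /= := count_mismatch (fun k : 'I_m => X u k w) (fun k => Z u k w) (lift ord0 j).
move=> /le_trans/(_ neq) h.
rewrite (_ : m%:R * Delta = m%:R * Delta / 2 + m%:R * Delta / 2); last by lra.
by apply: le_trans (lerD h devj); apply: le_trans (ler_normD _ _); rewrite addrA subrK.
Qed.

(** Column [Pi w u0] carries the row of [u0], so [pick] succeeds, and any column it returns must
    carry that row. The argument is pointwise in [w]. *)
Lemma match_estimator_correct m (u0 : 'I_n) (k : 'I_m) (Delta : R) w :
  freq_close Delta (fun l : 'I_m => Z u0 l w) (Pv u0 w) ->
  (forall u, u != u0 -> ~~ freq_close Delta (fun l : 'I_m => Z u l w) (Pv u0 w)) ->
  match_estimator u0 k Delta (observation m Z Pi w) [tuple Pv v w | v < n] =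
  Z u0 k w.
Proof.
move=> own other; rewrite /match_estimator tnth_mktuple.
have obsE u : freq_close Delta (fun l => observation m Z Pi w l u) (Pv u0 w) =
    freq_close Delta (fun l : 'I_m => Z ((Pi w)^-1%g u) l w) (Pv u0 w).
  by apply: eq_freq_close => l; rewrite mxE.
case: pickP => [u|/(_ (Pi w u0))]; rewrite obsE ?permK ?own//= mxE.
by case: (eqVneq ((Pi w)^-1%g u) u0) => [->//|/other/negbTE ->].
Qed.

(** The infimum is bounded by the error of the matching estimator, and that by a union bound: [E0]
    is null, [E1] alters the target entry, [E2] alters too many entries, [E3] is a large deviation
    of the true data in one of [q] coordinates, and [E4] is a false match with another user. *)
Lemma min_error_le m (u0 : 'I_n) (k : nat) (delta2 Delta : R) :
  (k < m)%N -> 0 < Delta ->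
  measurable_fun setT f -> (forall p, 0 <= f p <= delta2) ->
  (@min_error R d T P q.+1 n m (fun u => Pv u) X Z Pi u0 k <=
    (a + 2 * a / Delta + q%:R * (4 / (m%:R * Delta ^+ 2)) +
     n%:R * (delta2 * (2 * Delta) ^+ q))%:E)%E.
Proof.
move=> km D0 mf f2; pose k' := Ordinal km.
have m0 : (0 < m)%N by exact: leq_ltn_trans (leq0n k) km.
have m0' : 0 < m%:R :> R by rewrite ltr0n.
pose t := m%:R * Delta / 2.
have t0 : 0 < t by rewrite divr_gt0// mulr_gt0.
apply: ge_ereal_inf; exists (P [set w | match_estimator u0 k' Delta
    (observation m Z Pi w) [tuple Pv v w | v < n] <> X u0 k w]).
  by exists (match_estimator u0 k' Delta) => //; exact: match_estimatorP.
pose E0 := [set w | ~ simplex_interior q (Pv u0 w)].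
pose E1 := [set w | Z u0 k w <> X u0 k w].
pose E2 := [set w | t < #|[pred l : 'I_m | Z u0 l w != X u0 l w]|%:R].
pose F3 (j : 'I_q) := [set w |
  t < `|#|[pred l : 'I_m | X u0 l w == lift ord0 j]|%:R -
        m%:R * tnth (simplex_clip (Pv u0 w)) j|].
pose F4 u := [set w | freq_close Delta (fun l : 'I_m => Z u l w) (Pv u0 w)].
pose E3 := [set w | exists2 j, true & F3 j w].
pose E4 := [set w | exists2 u, u != u0 & F4 u w].
pose E := E0 `|` (E1 `|` (E2 `|` (E3 `|` E4))).
have mE0 : measurable E0 by exact: mNPu.
have mE1 : measurable E1 by exact: measurable_Z_neq_X.
have mE2 : measurable E2 by exact: measurable_count_Z_neq_X.
have mF3 j : measurable (F3 j) by exact: measurable_count_X_deviation.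
have mF4 u : measurable (F4 u) by exact: measurable_row_freq_close.
have mE3 : measurable E3.
  rewrite (_ : E3 = \bigcup_(j in [set: 'I_q]) F3 j).
    exact: fin_bigcup_measurable.
  by apply/seteqP; split => w [j _ Fj]; exists j.
have mE4 : measurable E4.
  rewrite (_ : E4 = \bigcup_(u in [set u | u != u0]) F4 u)//.
  by apply: fin_bigcup_measurable => //; exact: finite_finset.
apply: (@le_trans _ _ (P E)).
  apply: le_measure; rewrite ?inE.
  - have mg := fin_measurable_estimate (@match_estimatorP m u0 k' Delta).
    exact: (fin_measurable_preimage [set p | p.1 <> p.2]
      (fin_measurable_pair mg (@mX u0 k))).
  - by do 4 (apply: measurableU => //).
  move=> w /= err; apply: contrapT => nE; apply: err.
  have [n0 /not_orP[n1 /not_orP[n2 /not_orP[n3 n4]]]] :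
    ~ E0 w /\ ~ (E1 w \/ E2 w \/ E3 w \/ E4 w) by exact/not_orP.
  rewrite match_estimator_correct; first exact: contrapT.
  - apply: own_row_freq_close => //; first exact: contrapT.
      by rewrite leNgt; apply/negP => Zw; exact: n2.
    by move=> j; rewrite leNgt; apply/negP => Fj; apply: n3; exists j.
  - by move=> u uu0; apply/negP => Fu; apply: n4; exists u.
have P0 : (P E0 <= 0)%E by rewrite /E0 Pv_off_simplex.
have P1 : (P E1 <= a%:E)%E by exact: Z_neq_X_le.
have P2 : (P E2 <= (2 * a / Delta)%:E)%E.
  apply: le_trans (count_Z_neq_X u0 m t0) _; rewrite lee_fin le_eqVlt; apply/orP; left.
  by apply/eqP; rewrite /t; field; rewrite !gt_eqF.
have P3 : (P E3 <= (q%:R * (4 / (m%:R * Delta ^+ 2)))%:E)%E.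
  apply: le_trans (measure_bigsetU_le _ _) _ => //.
  rewrite mulr_natl -[X in _ *+ X]card_ord -sumr_const -sumEFin.
  apply: lee_sum => j _; apply: le_trans (count_X_deviation u0 m j t0) _.
  rewrite lee_fin le_eqVlt; apply/orP; left.
  by apply/eqP; rewrite /t; field; rewrite !gt_eqF.
have b0 : 0 <= delta2 * (2 * Delta) ^+ q.
  rewrite mulr_ge0//; last by rewrite exprn_ge0// mulr_ge0// ltW.
  by case/andP: (f2 [tuple of nseq q 0]) => /le_trans; apply.
have P4 : (P E4 <= (n%:R * (delta2 * (2 * Delta) ^+ q))%:E)%E.
  apply: le_trans (measure_bigsetU_le _ _) _ => //.
  rewrite mulr_natl -[X in _ *+ X]card_ord -sumr_const -sumEFin.
  rewrite [leLHS]big_mkcond/=; apply: lee_sum => u _; case: ifPn => [uu0|_].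
    by apply: other_row_freq_close => //; exact: ltW.
  by rewrite lee_fin.
apply: le_trans (measureU2 _ _ _) _ => //; first by do 3 (apply: measurableU => //).
rewrite -[leRHS]add0e -!addrA !EFinD; apply: leeD => //.
apply: le_trans (measureU2 _ _ _) _ => //; first by do 2 (apply: measurableU => //).
apply: leeD => //; apply: le_trans (measureU2 _ _ _) _ => //; first exact: measurableU.
by apply: leeD => //; apply: le_trans (measureU2 _ _ _) _ => //; exact: leeD.
Qed.

End model_laws.

(** * Asymptotics *)

Section powers.
Context {R : realType}.

Lemma natr_powR_cvgy (e : R) : 0 < e -> n.+1%:R `^ e @[n --> \oo] --> +oo.
Proof.
move=> e0; apply/cvgryPge => A.
near=> n; have An : `|A| `^ e^-1 <= n.+1%:R.
  by apply: le_trans (_ : n%:R <= _); [near: n; exact: nbhs_infty_ger|rewrite ler_nat].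
apply: le_trans (ler_norm A) _.
have -> : `|A| = (`|A| `^ e^-1) `^ e.
  by rewrite -powRrM mulVf ?gt_eqF// powRr1.
by apply: (ge0_ler_powR (ltW e0)); rewrite ?nnegrE ?powR_ge0.
Unshelve. all: end_near. Qed.

Lemma natr_powRN_cvg0 (e : R) : 0 < e -> n.+1%:R `^ (- e) @[n --> \oo] --> 0.
Proof.
move=> e0; under eq_fun do rewrite powRN.
apply/gtr0_cvgV0; first by near=> n; rewrite powR_gt0.
exact: natr_powR_cvgy.
Unshelve. all: end_near. Qed.

Lemma natr_powRN_cvg0M (b e : R) : 0 < e ->
  b * n.+1%:R `^ (- e) @[n --> \oo] --> 0.
Proof.
move=> e0; rewrite -[X in _ --> X](mulr0 b).
by apply: cvgM; [exact: cvg_cst|exact: natr_powRN_cvg0].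
Qed.

(** The base [n.+1] is never 0, so exponents of any sign may be added. *)
Lemma natr_powRD (n : nat) (r s : R) :
  n.+1%:R `^ r * n.+1%:R `^ s = n.+1%:R `^ (r + s) :> R.
Proof. by rewrite powRD// pnatr_eq0 implybT. Qed.

End powers.

(* The n-th probability space carries the model with n.+1 users, user 1 being
   ord0, so that the parameters are evaluated at n.+1. *)
Theorem theorem4 (R : realType) (r : nat) (f : r.-1.-tuple R -> R)
    (delta1 delta2 c c' alpha beta : R) (m : nat -> nat) (a : nat -> R)
    (d : nat -> measure_display) (T : forall n, measurableType (d n))
    (P : forall n, probability (T n) R)
    (Pv : forall n, 'I_n.+1 -> {RV (P n) >-> r.-1.-tuple R})
    (X : forall n, 'I_n.+1 -> nat -> T n -> 'I_r)
    (Rv : forall n, 'I_n.+1 -> {RV (P n) >-> R})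
    (Z : forall n, 'I_n.+1 -> nat -> T n -> 'I_r)
    (Pi : forall n, T n -> {perm 'I_n.+1}) :
  (2 <= r)%N ->
  is_density f ->
  continuous_tuple_on (simplex_interior r.-1) f ->
  0 < delta1 -> 0 < delta2 ->
  (forall p, simplex_interior r.-1 p -> delta1 < f p < delta2) ->
  (forall p, ~ simplex_interior r.-1 p -> f p = 0) ->
  0 < c -> 0 < alpha < 1 ->
  (forall n, `|(m n)%:R - c * n%:R `^ (2 / r.-1%:R + alpha)| < 1) ->
  0 < c' -> alpha / 4 < beta ->
  (forall n, a n = c' * n%:R `^ (- (1 / r.-1%:R + beta))) ->
  (forall n, a n.+1 <= 1 ->
    iid_model f (a n.+1) (Pv n) (X n) (Rv n) (Z n) (Pi n)) ->
  forall k : nat,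
    (fun n => @min_error R (d n) (T n) (P n) r n.+1 (m n.+1)
                (Pv n) (X n) (Z n) (Pi n) ord0 k) @ \oo --> 0%E.
Proof.
(* With [r = q'.+2], the dimension [r.-1] reduces to [q = q'.+1] and the results for [q.+1] states
   apply. *)
case: r f Pv X Z => [|[|q']] f Pv X Z //; set q := q'.+1 => _.
move=> [mf f_ge0 _] _ d1 d2 f_in f_out c0 /andP[alpha0 alpha1] mE c'0 ab aE model k.
have q0 : 0 < q%:R :> R by rewrite ltr0n.
pose eta := 1 / q%:R + alpha / 4.
pose Delta n : R := n.+1%:R `^ (- eta).
have beta0 : 0 < beta by apply: lt_trans ab; rewrite divr_gt0.
(* The four terms of [min_error_le] after inserting [a], the lower bound on [m] and [Delta]; the
   exponents are negative because [alpha / 4 < beta] and [0 < alpha]. *)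
pose B n : R := c' * n.+1%:R `^ (- (1 / q%:R + beta)) +
  2 * c' * n.+1%:R `^ (- (beta - alpha / 4)) +
  q%:R * (8 / c) * n.+1%:R `^ (- (alpha / 2)) +
  delta2 * 2 ^+ q * n.+1%:R `^ (- (q%:R * (alpha / 4))).
have iq0 : 0 < 1 / q%:R :> R by rewrite divr_gt0.
have B0 : B n @[n --> \oo] --> (0 : R).
  have add0 (u v : nat -> R) : u n @[n --> \oo] --> (0 : R) ->
      v n @[n --> \oo] --> (0 : R) -> u n + v n @[n --> \oo] --> (0 : R).
    by move=> u0 v0; rewrite -[X in _ --> X](addr0 0); exact: cvgD.
  rewrite /B; apply: (add0).
    apply: (add0).
      apply: (add0); apply: natr_powRN_cvg0M; first exact: addr_gt0.
      by rewrite subr_gt0.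
    by apply: natr_powRN_cvg0M; rewrite divr_gt0.
  by apply: natr_powRN_cvg0M; rewrite mulr_gt0// divr_gt0.
pose gamma := 2 / q%:R + alpha.
have gamma0 : 0 < gamma by rewrite addr_gt0// divr_gt0.
have f2 p : 0 <= f p <= delta2.
  rewrite f_ge0/=; have [/f_in/andP[_ /ltW]//|/f_out ->] := pselect (simplex_interior q p).
  exact: ltW.
have bound : \forall n \near \oo, (0 <= @min_error R (d n) (T n) (P n) q.+1 n.+1 (m n.+1)
    (Pv n) (X n) (Z n) (Pi n) ord0 k <= (B n)%:E)%E.
  have aS : a n.+1 @[n --> \oo] --> (0 : R).
    under eq_fun do rewrite aE.
    by apply: natr_powRN_cvg0M; rewrite addr_gt0.
  near=> n.
  (* The model is assumed only for such [n]; since [a] tends to 0, these are all large [n]. *)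
  have a1 : a n.+1 <= 1.
    by near: n; apply: (cvgr_le 0 aS).
  have Ngamma : (k.+2%:R + 2) / c <= n.+1%:R `^ gamma.
    by near: n; move/cvgryPge: (natr_powR_cvgy gamma0); apply.
  have := mE n.+1; rewrite -/gamma ltr_norml => /andP[m_lb _].
  have Ng : k.+2%:R + 2 <= c * n.+1%:R `^ gamma by rewrite mulrC -ler_pdivrMr.
  have km : (k < m n.+1)%N by rewrite -(ltr_nat R); move: m_lb Ng; rewrite -natr1 -natr1; lra.
  have mlb : c / 2 * n.+1%:R `^ gamma <= (m n.+1)%:R.
    have : 0 <= k.+2%:R :> R by []. 
    by move: m_lb Ng; lra.
  have D0 : 0 < Delta n by rewrite powR_gt0.
  apply/andP; split.
    by apply: le_ereal_inf_tmp => _ [g _ <-]; exact: measure_ge0.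
  apply: le_trans (min_error_le (erefl : (0 < q)%N) a1 f_out (model n a1) ord0 km D0 mf f2) _.
  rewrite lee_fin /B; apply: lerD; [apply: lerD; [apply: lerD|]|].
  - by rewrite aE.
  - rewrite aE /Delta -powRN opprK -!mulrA natr_powRD.
    rewrite (_ : - (1 / q%:R + beta) + eta = - (beta - alpha / 4))//.
    by rewrite /eta; lra.
  - rewrite -mulrA ler_wpM2l//.
    (* The exponent is [gamma - 2 * eta = alpha / 2]; the factor [c / 2] turns the 4 of the
       Chebyshev term into [8 / c]. *)
    have mD : c / 2 * n.+1%:R `^ (alpha / 2) <= (m n.+1)%:R * Delta n ^+ 2.
      rewrite (_ : alpha / 2 = gamma + (- eta + - eta)); last by rewrite /gamma /eta; lra.
      by rewrite -(natr_powRD n gamma) mulrA -(natr_powRD n (- eta)) -expr2 ler_wpM2r// exprn_ge0// ltW.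
    have cN0 : 0 < c / 2 * n.+1%:R `^ (alpha / 2) by rewrite mulr_gt0 ?powR_gt0// divr_gt0.
    rewrite (_ : 8 / c * _ = 4 / (c / 2 * n.+1%:R `^ (alpha / 2))); last first.
      by rewrite powRN; field; rewrite !gt_eqF ?powR_gt0.
    by rewrite ler_wpM2l// lef_pV2// posrE// (lt_le_trans cN0).
  - rewrite exprMn /Delta -(powR_mulrn q (powR_ge0 _ (- eta))) -powRrM.
    rewrite mulrCA -!mulrA ler_wpM2l ?(ltW d2)// mulrCA ler_wpM2l ?exprn_ge0//.
    (* The number of users is read as a power with exponent 1, and
       [1 - q * eta = - (q * alpha / 4)]: the false matches vanish in total. *)
    rewrite -{1}(powRr1 (ler0n R n.+1)) natr_powRD.
    rewrite (_ : 1 + - eta * q%:R = - (q%:R * (alpha / 4)))//.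
    by rewrite /eta; field; rewrite gt_eqF.
apply: (squeeze_cvge bound); first exact: cvg_cst.
by apply: cvg_EFin => //; near=> n.
Unshelve. all: end_near. Qed.
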